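(* Let $0<\alpha\le1$, $\epsilon>0$, and let $M^\epsilon_\alpha(t)=M(G^{(\epsilon)}_\alpha(t))$, $t\ge0$, where $\{M(t)\}_{t\ge0}$ is a generalized counting process with positive rates $\lambda_1,\dots,\lambda_k$, independent of the subordinator $\{G^{(\epsilon)}_\alpha(t)\}_{t\ge0}$ with Laplace exponent $\phi^{(\epsilon)}(\eta)=\alpha\epsilon^{-\alpha}\gamma(\alpha;\eta\epsilon)$, $\eta>0$. Then the following asymptotic result holds for the tail probability of $\{M^\epsilon_\alpha(t)\}_{t\ge0}$: $$\Pr\{M^\epsilon_\alpha(t)>y\}\sim\frac{t\,c_1^\alpha\,y^{-\alpha}}{\Gamma(1-\alpha)},\qquad y\to\infty,$$ where $c_1=\lambda_1+2\lambda_2+\cdots+k\lambda_k$.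
   Context: Generalized counting process (GCP): for $k\ge1$ and $\lambda_1,\dots,\lambda_k>0$, it is the non-negative integer valued Lévy process $\{M(t)\}_{t\ge0}$, $M(0)=0$, with $\Pr\{M(t+h)=n+j\mid M(t)=n\}=1-\Lambda h+o(h)$ for $j=0$, $=\lambda_jh+o(h)$ for $1\le j\le k$, $=o(h)$ for $j\ge k+1$, where $\Lambda=\sum_{j=1}^k\lambda_j$ and $o(h)/h\to0$ as $h\to0$. Equivalently $\mathbb{E}(u^{M(t)})=\exp(-t\sum_{j=1}^k\lambda_j(1-u^j))$ for $|u|\le1$. $\gamma(\alpha;\eta)=\int_0^\eta e^{-x}x^{\alpha-1}\,\mathrm{d}x$ is the lower incomplete gamma function, and $\Gamma$ is the gamma function. The subordinator $\{G^{(\epsilon)}_\alpha(t)\}_{t\ge0}$ is the non-decreasing Lévy process with $\mathbb{E}(e^{-\eta G^{(\epsilon)}_\alpha(t)})=\exp(-t\phi^{(\epsilon)}(\eta))$, $\eta>0$. The notation $f\sim g$ means $f/g\to1$.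
   Formalization: The equivalence ~ is stated for t>0 and 0<α<1 only: for α=1 or t=0 the right-hand side is identically 0 (1/Γ(0)=0), so f/g→1 is undefined; there the result is that y^α Pr{M^ε_α(t)>y} tends to t c_1^α/Γ(1-α), that is, to 0. *)

(* Defs.v *)
From HB Require Import structures.
From mathcomp Require Import all_boot all_order all_algebra.
From mathcomp Require Import all_classical all_reals all_analysis.

Set Implicit Arguments.
Unset Strict Implicit.
Unset Printing Implicit Defensive.

Import Order.TTheory GRing.Theory Num.Theory.
Import numFieldNormedType.Exports.

Local Open Scope classical_set_scope.
Local Open Scope ring_scope.

(* Extended-real valued, so that [Gamma 0 = +oo] and, with the library's
   inverse on [\bar R], [(Gamma 0)^-1 = 0]: the usual convention 1/Gamma(0) = 0
   is obtained without a special case. *)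
Definition Gamma {R : realType} (a : R) : \bar R :=
  (\int[lebesgue_measure]_(x in `]0%R, +oo[) (expR (- x) * x `^ (a - 1))%:E)%E.

Definition lower_gamma {R : realType} (a eta : R) : R :=
  \int[lebesgue_measure]_(x in `]0, eta]) (expR (- x) * x `^ (a - 1)).

(* Stochastic processes are families indexed by [R] of functions on the sample
   space; only the times [0 <= t] matter. *)

(* Stochastic continuity is not listed: it follows from right-continuity at 0
   and stationarity of the increments.  [X 0 = 0] and the cadlag property are
   required of every path; in particular a cadlag process composed with an
   independent time change is again a family of measurable functions. *)
Record is_levy {d : measure_display} {T : measurableType d} {R : realType}
    (P : probability T R) (X : R -> T -> R) : Prop := IsLevy {
  levy_measurable : forall t : R, 0 <= t -> measurable_fun setT (X t) ;
  levy_start : forall w, X 0 w = 0 ;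
  levy_indep_increments : forall (n : nat) (t : nat -> R) (B : nat -> set R),
    0 <= t 0%N -> (forall i, t i <= t i.+1) -> (forall i, measurable (B i)) ->
    P (\bigcap_(i < n) [set w | B i (X (t i.+1) w - X (t i) w)]) =
    (\prod_(i < n) P [set w | B i (X (t i.+1) w - X (t i) w)%R])%E ;
  levy_stationary_increments : forall (s h : R) (B : set R),
    0 <= s -> 0 <= h -> measurable B ->
    P [set w | B (X (s + h) w - X s w)] = P [set w | B (X h w)] ;
  levy_right_continuous : forall w (t : R), 0 <= t -> X s w @[s --> t^'+] --> X t w ;
  levy_left_limits : forall w (t : R), 0 < t -> cvg (X s w @[s --> t^'-])
}.

Definition cond_prob {d : measure_display} {T : measurableType d}
    {R : realType} (P : probability T R) (A B : set T) : R :=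
  fine (P (A `&` B)) / fine (P B).

Definition small_o {R : realType} (f : R -> R) : Prop :=
  f h / h @[h --> 0^'+] --> 0.

(* The main part of Pr{M(t+h) = n+j | M(t) = n}. *)
Definition gcp_transition {R : realType} (k : nat) (lam : nat -> R) (j : nat)
    (h : R) : R :=
  if j == 0%N then 1 - (\sum_(1 <= i < k.+1) lam i) * h
  else if (j <= k)%N then lam j * h else 0.

(* The rates are [lam 1, ..., lam k]; other values of [lam] are irrelevant. *)
Definition is_gcp {d : measure_display} {T : measurableType d} {R : realType}
    (P : probability T R) (k : nat) (lam : nat -> R) (M : R -> T -> nat) : Prop :=
  is_levy P (fun t w => (M t w)%:R) /\
  forall (t : R) (n j : nat), 0 <= t -> (0 < P [set w | M t w = n])%E ->
    small_o (fun h =>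
      cond_prob P [set w | M (t + h) w = (n + j)%N] [set w | M t w = n] -
      gcp_transition k lam j h).

Definition is_subordinator {d : measure_display} {T : measurableType d}
    {R : realType} (P : probability T R) (phi : R -> R) (G : R -> T -> R) : Prop :=
  [/\ is_levy P G,
      forall w (s t : R), 0 <= s -> s <= t -> G s w <= G t w &
      forall t eta : R, 0 <= t -> 0 < eta ->
        'E_P[(fun w => expR (- eta * G t w))]%E = (expR (- t * phi eta))%:E].

Definition process_sigma {d : measure_display} {T : measurableType d}
    {R : realType} (X : R -> T -> R) : set (set T) :=
  <<s \bigcup_(t in [set t : R | 0 <= t])
        preimage_set_system setT (X t) measurable >>.

Definition indep_processes {d : measure_display} {T : measurableType d}
    {R : realType} (P : probability T R) (X Y : R -> T -> R) : Prop :=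
  forall A B, process_sigma X A -> process_sigma Y B ->
    P (A `&` B) = (P A * P B)%E.

Definition asymp_equiv {R : realType} (f g : R -> R) : Prop :=
  f y / g y @[y --> +oo] --> (1 : R).

(* Main.v *)
Require Import Defs.
From HB Require Import structures.
From mathcomp Require Import all_boot all_order all_algebra.
From mathcomp Require Import all_classical all_reals all_analysis.
From mathcomp Require Import measurable_realfun.
From mathcomp Require Import ring lra.

Set Implicit Arguments.
Unset Strict Implicit.
Unset Printing Implicit Defensive.

Import Order.TTheory GRing.Theory Num.Theory.
Import numFieldNormedType.Exports.

Local Open Scope classical_set_scope.
Local Open Scope ring_scope.

(* The law of [M s] is an exponential semigroup in [s], so its Laplace transform
   at [eta] is [exp (- s psi(eta))] with [psi(eta) ~ c1 eta] at 0; independence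
   gives [X = M (G t)] the Laplace transform [exp (- t phi(psi(eta)))], and
   [1 - E exp (- eta X) ~ t (c1 eta)^alpha] because [phi(eta) ~ eta^alpha].
   Karamata's Tauberian argument turns this into the tail: with
   [Z = exp (- X / y)], the limits of [y^alpha E (1 - Z^m)] give those of
   [y^alpha E ((1 - Z) p(Z))] for every polynomial [p], and they are the integrals
   of [(1 - z) p(z)], [z = exp (- x)], against a multiple of the measure
   [alpha x^(- alpha - 1) dx].  One-sided polynomial approximation of the
   indicator of [z < exp (- 1)] then determines the limit of
   [y^alpha Pr (X > y)].  For [alpha = 1] the single polynomial [(1 - z)^2]
   suffices. *)

(** The measure [alpha x^(- alpha - 1) dx] is infinite near [x = 0], that is near [z = 1], so
    polynomials in [z] are integrable against it only when they carry the factor [1 - z]. For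
    [0 < alpha < 1] it gives [1 - z^m] the integral [m^alpha Gamma(1 - alpha)] and the half-line
    [x >= 1] the mass 1; comparing the moments therefore divides the limit constant by
    [Gamma(1 - alpha)]. Two obstacles come from the processes. The transition conditions hold for
    each jump size separately and give no uniform control of [Pr (M h > k)], so the Laplace
    transform of [M h] is squeezed between expressions that involve only the probabilities of
    [0, ..., k]. Independence is a factorisation of probabilities of events, while [M (G t)] reads
    the path of [M] at a random time, so the conditioning on [G t] is carried out on a countable
    grid and followed by a limit. *)

(** * Polynomial approximation *)

(* The expectation of [g] at a binomial variable with parameter ['X], obtained by
   conditioning on one trial. *)
Fixpoint bernstein {R : realType} (n : nat) (g : nat -> R) : {poly R} :=
  if n is m.+1 then
    (1 - 'X) * bernstein m g + 'X * bernstein m (fun i => g i.+1)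
  else (g 0%N)%:P.

Lemma bernsteinS_horner (R : realType) n (g : nat -> R) (x : R) :
  (bernstein n.+1 g).[x] =
  (1 - x) * (bernstein n g).[x] + x * (bernstein n (fun i => g i.+1)).[x].
Proof. by rewrite /= !hornerE. Qed.

Lemma bernstein_le (R : realType) n (g h : nat -> R) (x : R) :
  0 <= x <= 1 -> (forall i, g i <= h i) ->
  (bernstein n g).[x] <= (bernstein n h).[x].
Proof.
move=> /andP[x0 x1]; elim: n g h => [|n IH] g h gh; first by rewrite /= !hornerE.
by rewrite !bernsteinS_horner lerD// ler_wpM2l ?subr_ge0// IH.
Qed.

Lemma bernstein_affine (R : realType) n (a b : R) (g : nat -> R) (x : R) :
  (bernstein n (fun i => a * g i + b)).[x] = a * (bernstein n g).[x] + b.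
Proof.
elim: n g => [|n IH] g; first by rewrite /= !hornerE.
rewrite !bernsteinS_horner (IH g) (IH (fun i => g i.+1)); ring.
Qed.

(** Variance plus squared bias of a binomial variable. The centre [c] stays arbitrary because the
    success branch of the recursion replaces it by [c - 1]. *)
Lemma bernstein_variance (R : realType) n (c x : R) :
  (bernstein n (fun i => (i%:R - c) ^+ 2)).[x] =
  n%:R * x * (1 - x) + (n%:R * x - c) ^+ 2.
Proof.
elim: n c => [|n IH] c; first by rewrite /= !hornerE; ring.
rewrite bernsteinS_horner IH.
under [X in bernstein n X]eq_fun => i.
  have -> : i.+1%:R - c = i%:R - (c - 1) by rewrite -natr1; ring.
  over.
by rewrite IH -natr1; ring.
Qed.

(** Chebyshev's argument without probabilities: with [u = |i / n - x|], [K u <= K (u^2 / d + d)],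
    and the binomial mean of [u^2] is [x (1 - x) / n <= d^2]. The total error is at most [2 K d],
    whence [d = e / (2 K)] and [n >= 1 / d^2]. *)
Lemma lipschitz_poly_approx (R : realType) (f : R -> R) (K e : R) :
  0 < K -> 0 < e -> (forall x y, `|f x - f y| <= K * `|x - y|) ->
  exists p : {poly R}, forall x, 0 <= x <= 1 -> `|p.[x] - f x| <= e.
Proof.
move=> K0 e0 fK; have [d dE] : exists d, d = e / (2 * K) by eexists.
have d0 : 0 < d by rewrite dE divr_gt0// mulr_gt0.
have [n n0 nd] : exists2 n, 0 < n%:R :> R & 1 / n%:R <= d ^+ 2.
  exists (Num.truncn (d ^- 2)).+1; first by rewrite ltr0n.
  rewrite ler_pdivrMr ?ltr0n// mulrC -ler_pdivrMr ?exprn_gt0// mul1r ltW//.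
  exact: truncnS_gt.
exists (bernstein n (fun i => f (i%:R / n%:R))) => x x01.
have /andP[x0 x1] := x01.
pose a := K / (d * n%:R ^+ 2).
have aE : a * (n%:R * x * (1 - x)) <= K * d.
  have -> : a * (n%:R * x * (1 - x)) = K / d * (1 / n%:R * (x * (1 - x))).
    by rewrite /a; field; rewrite !gt_eqF.
  rewrite -[leRHS](_ : K / d * d ^+ 2 = _); last by field; rewrite gt_eqF.
  rewrite ler_pM2l ?divr_gt0//; apply: le_trans nd.
  rewrite ler_piMr ?divr_ge0//; nra.
have bnd i : `|f (i%:R / n%:R) - f x| <= a * (i%:R - n%:R * x) ^+ 2 + K * d.
  apply: le_trans (fK _ _) _.
  set u := `|_ - _|.
  have u2 : (i%:R - n%:R * x) ^+ 2 = n%:R ^+ 2 * u ^+ 2.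
    rewrite /u real_normK ?num_real//; field; exact: lt0r_neq0.
  have -> : a * (i%:R - n%:R * x) ^+ 2 + K * d = K * (u ^+ 2 / d + d).
    by rewrite u2 /a; field; rewrite !gt_eqF.
  rewrite ler_pM2l// -(ler_pM2r d0) mulrDl divfK ?gt_eqF//.
  nra.
have var := bernstein_variance n (n%:R * x) x.
rewrite subrr expr0n/= addr0 in var.
have eE : e = K * d + K * d by rewrite dE; field; rewrite gt_eqF.
have lo : (bernstein n (fun i => - a * (i%:R - n%:R * x) ^+ 2 + (f x - K * d))).[x]
    <= (bernstein n (fun i => f (i%:R / n%:R))).[x].
  apply: bernstein_le => // i.
  have := bnd i; rewrite ler_distl => /andP[+ _]; lra.
have hi : (bernstein n (fun i => f (i%:R / n%:R))).[x] <=
    (bernstein n (fun i => a * (i%:R - n%:R * x) ^+ 2 + (f x + K * d))).[x].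
  apply: bernstein_le => // i.
  have := bnd i; rewrite ler_distl => /andP[_ +]; lra.
rewrite ler_distl; move: lo hi aE; rewrite !bernstein_affine var eE; lra.
Qed.

(* The target [1_{z < z1} / (1 - z)], mollified to be Lipschitz, is approximated
   before multiplying by [1 - z]: this makes the error proportional to
   [1 - z], hence integrable against measures that are infinite near [z = 1]. *)
Lemma step_poly_approx (R : realType) (z1 z2 e : R) :
  0 < z1 -> z1 < z2 -> z2 < 1 -> 0 < e ->
  exists p : {poly R}, forall z, 0 <= z <= 1 ->
    (z < z1)%R%:R - e * (1 - z) <= (1 - z) * p.[z] <=
    (z <= z2)%R%:R + e * (1 - z).
Proof.
move=> z10 z12 z21 e0.
(* [F] falls linearly from 1 at [z1] to 0 at [z2]. [g] is [1 / (1 - z)] frozen beyond [z2], where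
   [F] vanishes anyway, so [F * g] has no singularity at [z = 1] and is Lipschitz. *)
pose F z := Num.max 0 (Num.min 1 ((z2 - z) / (z2 - z1))) : R.
pose g z := (1 - Num.min z z2)^-1 : R.
have d0 : 0 < z2 - z1 by rewrite subr_gt0.
have b0 : 0 < 1 - z2 by rewrite subr_gt0.
have F01 z : 0 <= F z <= 1.
  rewrite /F; set u := _ / _; rewrite /Num.max /Num.min.
  by case: ifP; case: ifP; lra.
have m0 z : 1 - z2 <= 1 - Num.min z z2.
  by rewrite lerD2l lerN2 ge_min lexx orbT.
have m00 z : 0 < 1 - Num.min z z2 by exact: lt_le_trans (m0 z).
have g0 z : 0 <= g z <= (1 - z2)^-1.
  by rewrite /g invr_ge0 ltW//= lef_pV2 ?posrE.
have FL x y : `|F x - F y| <= (z2 - z1)^-1 * `|x - y|.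
  have -> : (z2 - z1)^-1 * `|x - y| =
      `|(z2 - x) / (z2 - z1) - (z2 - y) / (z2 - z1)|.
    rewrite -mulrBl normrM (ger0_norm (_ : 0 <= (z2 - z1)^-1)) ?invr_ge0 ?ltW//.
    by rewrite mulrC; congr (_ * _); rewrite -normrN; congr `|_|; ring.
  rewrite /F; set u := _ / _; set v := _ / _; clearbody u v.
  rewrite /Num.max /Num.min.
  have := ler_norm (u - v); have := ler_norm (v - u); rewrite (distrC v u) => h1 h2.
  rewrite ler_norml.
  by case: ifP; case: ifP; case: ifP; case: ifP; lra.
have gL x y : `|g x - g y| <= (1 - z2)^-2 * `|x - y|.
  have -> : g x - g y = g x * g y * (Num.min x z2 - Num.min y z2).
    by rewrite /g; field; rewrite !gt_eqF.
  have [gx0 gx1] := andP (g0 x); have [gy0 gy1] := andP (g0 y).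
  rewrite normrM (ger0_norm (mulr_ge0 _ _))//; apply: ler_pM => //.
  - exact: mulr_ge0.
  - by rewrite expr2 invfM ler_pM.
  - have := ler_norm (x - y); have := ler_norm (y - x); rewrite (distrC y x) => h1 h2.
    by rewrite ler_norml /Num.min; case: ifP; case: ifP; lra.
pose K := (z2 - z1)^-1 * (1 - z2)^-1 + (1 - z2)^-2.
have K0 : 0 < K by rewrite addr_gt0 ?mulr_gt0 ?invr_gt0 ?exprn_gt0 ?invr_gt0.
have qL x y : `|F x * g x - F y * g y| <= K * `|x - y|.
  have -> : F x * g x - F y * g y = (F x - F y) * g x + F y * (g x - g y) by ring.
  apply: le_trans (ler_normD _ _) _; rewrite !normrM mulrDl; apply: lerD.
    rewrite mulrAC; apply: ler_pM => //.
    by have [? ?] := andP (g0 x); rewrite ger0_norm.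
  rewrite -[leRHS]mul1r; apply: ler_pM => //.
  by have [? ?] := andP (F01 y); rewrite ger0_norm.
have [p pP] := lipschitz_poly_approx K0 e0 qL.
exists p => z z01; have := pP z z01; rewrite ler_distl => /andP[pl pu].
have [z0 z1'] := andP z01.
have qlo : (z < z1)%R%:R <= (1 - z) * (F z * g z).
  have [zz1|_] := ltP z z1; last first.
    have [? _] := andP (F01 z); have [? _] := andP (g0 z).
    by rewrite !mulr_ge0// subr_ge0.
  have -> : F z = 1.
    rewrite /F; set u := _ / _.
    have : 1 <= u by rewrite /u ler_pdivlMr//; lra.
    by rewrite /Num.max /Num.min => ?; case: ifP; case: ifP; lra.
  rewrite /g min_l; last by lra.
  rewrite mul1r divff//; lra.
have qhi : (1 - z) * (F z * g z) <= (z <= z2)%R%:R.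
  have [_ F1] := andP (F01 z).
  have [zz2|zz2] := leP z z2.
    rewrite /g min_l// mulrCA divff ?mulr1//; lra.
  have -> : F z = 0.
    rewrite /F; set u := _ / _.
    have : u <= 0 by rewrite /u ler_pdivrMr//; lra.
    by rewrite /Num.max /Num.min => ?; case: ifP; case: ifP; lra.
  by rewrite mul0r mulr0.
move: qlo qhi pl pu; set q := F z * g z; clearbody q; move: (_%:R) (_%:R) => A B.
by move=> qlo qhi pl pu; apply/andP; split; nra.
Qed.

Lemma step_poly_above (R : realType) (z1 z2 e : R) :
  0 < z1 -> z1 < z2 -> z2 < 1 -> 0 < e ->
  exists p : {poly R}, forall z, 0 <= z <= 1 ->
    (z < z1)%R%:R <= (1 - z) * p.[z] <= (z <= z2)%R%:R + e * (1 - z).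
Proof.
move=> z10 z12 z21 e0; have e20 : 0 < e / 2 by rewrite divr_gt0.
have [p pP] := step_poly_approx z10 z12 z21 e20.
exists (p + (e / 2)%:P) => z /pP; rewrite !hornerE => /andP[? ?].
by apply/andP; split; lra.
Qed.

Lemma step_poly_below (R : realType) (z1 z2 e : R) :
  0 < z1 -> z1 < z2 -> z2 < 1 -> 0 < e ->
  exists p : {poly R}, forall z, 0 <= z <= 1 ->
    (z < z1)%R%:R - e * (1 - z) <= (1 - z) * p.[z] <= (z <= z2)%R%:R.
Proof.
move=> z10 z12 z21 e0; have e20 : 0 < e / 2 by rewrite divr_gt0.
have [p pP] := step_poly_approx z10 z12 z21 e20.
exists (p - (e / 2)%:P) => z /pP; rewrite !hornerE => /andP[? ?].
by apply/andP; split; lra.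
Qed.

(** * Power functions and Gamma integrals *)

Lemma cvg_at_right0 (R : realType) (T : Type) (F : set_system T)
    (FF : Filter F) (f : T -> R) :
  (\forall x \near F, 0 < f x) -> f @ F --> 0 -> f @ F --> 0^'+.
Proof.
move=> f0 /cvgrPdist_lt fF A [e /= e0 eA].
near=> x; apply: eA => /=; last by near: x.
by near: x; exact: fF.
Unshelve. all: by end_near. Qed.

Lemma cvgVy_at_right (R : realType) : x^-1 @[x --> +oo] --> (0 : R)^'+.
Proof.
apply: cvg_at_right0.
  by near=> x; rewrite invr_gt0; near: x; exact: nbhs_pinfty_gt.
apply/gtr0_cvgV0; last exact: cvg_id.
by near=> x; near: x; exact: nbhs_pinfty_gt.
Unshelve. all: by end_near. Qed.

Lemma powR_continuous (R : realType) (p x : R) : 0 < x ->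
  {for x, continuous (fun y : R => y `^ p)}.
Proof.
move=> x0; apply/differentiable_continuous/derivable1_diffP.
by apply: derivable_powR; rewrite in_itv/= x0.
Qed.

Lemma powR_div_derive (R : realType) (p x : R) : p != 0 -> 0 < x ->
  (fun y => y `^ p / p)^`()%classic x = x `^ (p - 1).
Proof.
move=> p0 x0; have x0' : x \in `]0, +oo[ by rewrite in_itv/= x0.
rewrite derive1Mr; last exact: derivable_powR.
by rewrite powR_derive1// mulrAC divff// mul1r.
Qed.

Lemma powR_div_derivable (R : realType) (p x : R) : 0 < x ->
  derivable (fun y => y `^ p / p) x 1.
Proof.
by move=> x0; apply: derivableM => //; apply: derivable_powR; rewrite in_itv/= x0.
Qed.

Lemma powR_div_continuous (R : realType) (p x : R) : 0 < x ->
  {for x, continuous (fun y => y `^ p / p)}.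
Proof. by move=> x0; apply: cvgM; [exact: powR_continuous|exact: cvg_cst]. Qed.

Lemma integral_powR_itvcc (R : realType) (p a b : R) :
  p != 0 -> 0 < a -> a < b ->
  (\int[lebesgue_measure]_(x in `[a, b]) (x `^ (p - 1))%:E =
   (b `^ p / p)%:E - (a `^ p / p)%:E)%E.
Proof.
move=> p0 a0 ab.
rewrite (@continuous_FTC2 _ _ (fun x => x `^ p / p))//.
- apply: continuous_in_subspaceT => x; rewrite inE/= in_itv/= => /andP[ax _].
  by apply: powR_continuous; exact: lt_le_trans ax.
- split.
  + move=> x; rewrite in_itv/= => /andP[ax _].
    by apply: powR_div_derivable; exact: lt_trans ax.
  + by apply: cvg_at_right_filter; exact: powR_div_continuous.
  + by apply: cvg_at_left_filter; apply: powR_div_continuous; exact: lt_trans ab.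
- move=> x; rewrite in_itv/= => /andP[ax _].
  by rewrite powR_div_derive//; exact: lt_trans ax.
Qed.

(** For [p < 1] the integrand blows up at 0, so the fundamental theorem is applied on compact
    intervals that exhaust []0, c]], with monotone convergence. The denominator [n.+2] keeps each
    left endpoint strictly below [c]. *)
Lemma integral_powR_itvoc (R : realType) (p c : R) : 0 < p -> 0 < c ->
  (\int[lebesgue_measure]_(x in `]0%R, c]) (x `^ (p - 1))%:E = (c `^ p / p)%:E)%E.
Proof.
move=> p0 c0.
pose F (n : nat) := `[c / n.+2%:R, c]%classic : set R.
have nc n : 0 < c / n.+2%:R < c.
  by rewrite divr_gt0//= ltr_pdivrMr// ltr_pMr// ltr1n.
have UF : \bigcup_n F n = `]0, c]%classic.
  apply/seteqP; split => x /=.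
    move=> [n _]; rewrite /F/= !in_itv/= => /andP[h ->]; rewrite andbT.
    by have /andP[h' _] := nc n; exact: lt_le_trans h.
  rewrite in_itv/= => /andP[x0 xc]; exists (Num.truncn (c / x)) => //.
  rewrite /F/= in_itv/= xc andbT ler_pdivrMr// mulrC -ler_pdivrMr//.
  by rewrite ltW// (lt_trans (truncnS_gt _))// ltr_nat.
have h1 : (\int[lebesgue_measure]_(x in F n) (x `^ (p - 1))%:E @[n --> \oo] -->
    \int[lebesgue_measure]_(x in `]0%R, c]) (x `^ (p - 1))%:E)%E.
  rewrite -UF; apply: ge0_nondecreasing_set_cvg_integral.
  - move=> m n mn; apply/subsetPset => x; rewrite /F/= !in_itv/= => /andP[h ->].
    rewrite andbT; apply: le_trans h; rewrite ler_pM2l// lef_pV2 ?posrE//.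
    by rewrite ler_nat ltnS.
  - by move=> n; exact: measurable_itv.
  - move=> n; apply/measurable_EFinP; apply: measurable_funTS.
    exact: measurable_powR.
  - by move=> n x _; rewrite lee_fin powR_ge0.
have h2 : (\int[lebesgue_measure]_(x in F n) (x `^ (p - 1))%:E @[n --> \oo] -->
    (c `^ p / p)%:E)%E.
  apply: (@cvg_trans _ ((c `^ p / p - (c / n.+2%:R) `^ p / p)%:E @[n --> \oo])).
    apply: near_eq_cvg; near=> n; have /andP[? ?] := nc n.
    by rewrite integral_powR_itvcc ?gt_eqF.
  apply: cvg_EFin; first exact: nearW.
  rewrite -[X in _ --> X]subr0; apply: cvgB; first exact: cvg_cst.
  rewrite -(mul0r p^-1); apply: cvgM; last exact: cvg_cst.
  apply: (@cvg_comp _ _ _ (fun n => c / n.+2%:R) (fun y : R => y `^ p) _ 0^'+);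
    last exact: powR_cvg0.
  apply: cvg_at_right0.
    by apply: nearW => n; rewrite divr_gt0.
  rewrite -(mulr0 c); apply: cvgM; first exact: cvg_cst.
  by have := @cvg_harmonic R; rewrite -cvg_shiftS.
exact: cvg_unique h1 h2.
Unshelve. all: end_near. Qed.

Lemma integral_powR_itvcy (R : realType) (p c : R) : 0 < p -> 0 < c ->
  (\int[lebesgue_measure]_(x in `[c, +oo[) (x `^ (- p - 1))%:E =
   (c `^ (- p) / p)%:E)%E.
Proof.
move=> p0 c0.
have np0 : - p != 0 by rewrite oppr_eq0 gt_eqF.
rewrite (@ge0_continuous_FTC2y _ _ (fun x => x `^ (- p) / (- p)) c 0).
- by rewrite sub0e -EFinN invrN mulrN opprK.
- by move=> x _; exact: powR_ge0.
- apply: continuous_in_subspaceT => x; rewrite inE/= in_itv/= andbT => ax.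
  by apply: powR_continuous; exact: lt_le_trans ax.
- rewrite -(mul0r (- p)^-1); apply: cvgM; last exact: cvg_cst.
  apply: (@cvg_trans _ (x^-1 `^ p @[x --> +oo])).
    apply: near_eq_cvg; near=> x.
    rewrite -powR_inv1; last by near: x; exact: nbhs_pinfty_ge.
    by rewrite -powRrM mulN1r.
  exact: (cvg_comp _ _ (@cvgVy_at_right R) (powR_cvg0 p0)).
- by move=> x cx; apply: powR_div_derivable; exact: lt_trans cx.
- by apply: cvg_at_right_filter; exact: powR_div_continuous.
- move=> x; rewrite in_itv/= andbT => ax.
  by rewrite powR_div_derive//; exact: lt_trans ax.
Unshelve. all: by end_near. Qed.

Lemma Gamma_integrand_measurable (R : realType) (a : R) (D : set R) :
  measurable_fun D (fun x : R => (expR (- x) * x `^ (a - 1))%:E).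
Proof.
apply/measurable_EFinP; apply: measurable_funTS; apply: measurable_funM.
  by apply: measurableT_comp; [exact: measurable_expR|exact: oppr_measurable].
exact: measurable_powR.
Qed.

Lemma expRN_measurable (R : realType) (D : set R) :
  measurable_fun D (fun x : R => (expR (- x))%:E).
Proof.
apply/measurable_EFinP; apply: measurable_funTS.
by apply: measurableT_comp; [exact: measurable_expR|exact: oppr_measurable].
Qed.

Lemma expRN_continuous (R : realType) : continuous (fun y : R => expR (- y)).
Proof.
by move=> x; apply: continuous_comp; [exact: opp_continuous|exact: continuous_expR].
Qed.

Lemma expRN_derive (R : realType) (x : R) :
  (fun y : R => - expR (- y))^`()%classic x = expR (- x).
Proof.
by rewrite derive1E derive_val mulrN1 opprK.
Qed.

Lemma integral_expRN (R : realType) (b : R) : 0 < b ->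
  (\int[lebesgue_measure]_(x in `]0%R, b]) (expR (- x))%:E =
   (1 - expR (- b))%:E)%E.
Proof.
move=> b0; rewrite integral_itv_obnd_cbnd; last exact: expRN_measurable.
rewrite (@continuous_FTC2 _ _ (fun x => - expR (- x)))//.
- by rewrite oppr0 expR0 -EFinB opprK addrC.
- exact/continuous_subspaceT/expRN_continuous.
- split.
  + by move=> x _; exact: ex_derive.
  + by apply: cvg_at_right_filter; apply: cvgN; exact: expRN_continuous.
  + by apply: cvg_at_left_filter; apply: cvgN; exact: expRN_continuous.
- by move=> x _; rewrite expRN_derive.
Qed.

Lemma integral_expRN_powR_le (R : realType) (a c : R) : 0 < a -> 0 < c ->
  (\int[lebesgue_measure]_(x in `]0%R, c]) (expR (- x) * x `^ (a - 1))%:E <=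
   (c `^ a / a)%:E)%E.
Proof.
move=> a0 c0; rewrite -integral_powR_itvoc//; apply: ge0_le_integral => //.
- by move=> x _; rewrite lee_fin mulr_ge0 ?expR_ge0 ?powR_ge0.
- exact: Gamma_integrand_measurable.
- by apply/measurable_EFinP; apply: measurable_funTS; exact: measurable_powR.
- move=> x/=; rewrite in_itv/= => /andP[x0 _].
  by rewrite lee_fin ler_piMl ?powR_ge0// -expR0 ler_expR oppr_le0 ltW.
Qed.

Lemma integral_expRN_powR_ge (R : realType) (a c : R) : 0 < a -> 0 < c ->
  ((expR (- c) * (c `^ a / a))%:E <=
   \int[lebesgue_measure]_(x in `]0%R, c]) (expR (- x) * x `^ (a - 1))%:E)%E.
Proof.
move=> a0 c0; rewrite EFinM -integral_powR_itvoc// -ge0_integralZl//; last 2 first.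
- by apply/measurable_EFinP; apply: measurable_funTS; exact: measurable_powR.
- by move=> x _; rewrite lee_fin powR_ge0.
apply: ge0_le_integral => //.
- by move=> x _; rewrite -EFinM lee_fin mulr_ge0 ?expR_ge0 ?powR_ge0.
- apply: measurable_funeM; apply/measurable_EFinP; apply: measurable_funTS.
  exact: measurable_powR.
- exact: Gamma_integrand_measurable.
- move=> x/=; rewrite in_itv/= => /andP[_ xc].
  by rewrite -EFinM lee_fin ler_wpM2r ?powR_ge0// ler_expR lerN2.
Qed.

(** On []0, c]] the factor [expR (- x)] lies between [expR (- c)] and 1. Hence the incomplete gamma
    function behaves like [c^a / a] at 0, which is the source of [phi(eta) ~ eta^alpha]. *)
Lemma lower_gamma_bounds (R : realType) (a c : R) : 0 < a -> 0 < c ->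
  expR (- c) * (c `^ a / a) <= lower_gamma a c <= c `^ a / a.
Proof.
move=> a0 c0; have lo := integral_expRN_powR_ge a0 c0.
have hi := integral_expRN_powR_le a0 c0.
rewrite /lower_gamma /Rintegral -!lee_fin fineK ?lo ?hi//.
rewrite ge0_fin_numE; first exact: le_lt_trans hi (ltry _).
apply: integral_ge0 => x _; by rewrite lee_fin mulr_ge0 ?expR_ge0 ?powR_ge0.
Qed.

Lemma Gamma_ge (R : realType) (a c : R) : 0 < c ->
  (\int[lebesgue_measure]_(x in `]0%R, c]) (expR (- x) * x `^ (a - 1))%:E <=
   Gamma a)%E.
Proof.
move=> c0; apply: ge0_subset_integral => //.
- exact: Gamma_integrand_measurable.
- by move=> x _; rewrite lee_fin mulr_ge0 ?expR_ge0 ?powR_ge0.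
- by move=> x/=; rewrite !in_itv/= andbT => /andP[].
Qed.

Lemma Gamma_gt0 (R : realType) (a : R) : 0 < a -> (0 < Gamma a)%E.
Proof.
move=> a0; apply: lt_le_trans (Gamma_ge a ltr01).
apply: lt_le_trans (integral_expRN_powR_ge a0 ltr01).
by rewrite lte_fin mulr_gt0 ?expR_gt0// divr_gt0// powR_gt0.
Qed.

(** Below 1 the exponential is at most 1, above 1 the power is. The bound serves to make
    [Gamma (1 - alpha)] finite. *)
Lemma Gamma_le1 (R : realType) (a : R) : 0 < a -> a <= 1 ->
  (Gamma a <= (a^-1 + 1)%:E)%E.
Proof.
move=> a0 a1.
have U : `]0, 1] `|` `]1, +oo[ = `]0, +oo[%classic :> set R.
  by rewrite -itv_bndbnd_setU ?bnd_simp.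
rewrite /Gamma -U ge0_integral_setU//=; last 3 first.
- exact: Gamma_integrand_measurable.
- by move=> x _; rewrite lee_fin mulr_ge0 ?expR_ge0 ?powR_ge0.
- apply/disj_setPS => x [/=]; rewrite !in_itv/= andbT => /andP[_ x1] x1'.
  by move: x1; rewrite leNgt x1'.
rewrite EFinD; apply: leeD.
  have := integral_expRN_powR_le a0 (@ltr01 R).
  by rewrite powR1 mul1r.
apply: (@le_trans _ _ (\int[lebesgue_measure]_(x in `[0%R, +oo[) (expR (- x))%:E)%E).
  apply: (@le_trans _ _ (\int[lebesgue_measure]_(x in `]1%R, +oo[) (expR (- x))%:E)%E).
    apply: ge0_le_integral => //.
    - by move=> x _; rewrite lee_fin mulr_ge0 ?expR_ge0 ?powR_ge0.
    - exact: Gamma_integrand_measurable.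
    - exact: expRN_measurable.
    - move=> x/=; rewrite in_itv/= andbT => x1.
      rewrite lee_fin ler_piMr ?expR_ge0// -[leRHS](powRr0 x); apply: ler_powR; first exact: ltW.
      by rewrite subr_le0.
  apply: ge0_subset_integral => //; first exact: expRN_measurable.
  by move=> x/=; rewrite !in_itv/= !andbT => x1; rewrite (le_trans ler01)// ltW.
rewrite (@ge0_continuous_FTC2y _ _ (fun x => - expR (- x)) _ 0)//.
- by rewrite oppr0 expR0 EFinN oppeK add0e.
- exact/continuous_subspaceT/expRN_continuous.
- by rewrite -oppr0; apply: cvgN; exact: cvgr_expR.
- by apply: cvg_at_right_filter; apply: cvgN; exact: expRN_continuous.
- by move=> x _; rewrite expRN_derive.
Qed.

(** On []0, 1]] the integrand dominates the one with exponent [a - 1] for every [a > 0], whose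
    integral is at least [exp (- 1) / a]. The chosen [a] makes this at least [A]. *)
Lemma Gamma0 (R : realType) : Gamma (0 : R) = +oo%E.
Proof.
apply/eqyP => A A0.
pose a := (Num.max 1 (A * expR 1))^-1.
have M0 : 0 < Num.max 1 (A * expR 1) by rewrite lt_max ltr01.
have a0 : 0 < a by rewrite invr_gt0.
apply: le_trans (Gamma_ge 0 ltr01).
apply: (@le_trans _ _ (\int[lebesgue_measure]_(x in `]0%R, 1%R]) (expR (- x) * x `^ (a - 1))%:E)%E).
  apply: le_trans (integral_expRN_powR_ge a0 ltr01).
  rewrite powR1 /a mul1r invrK lee_fin expRN mulrC ler_pdivlMr ?expR_gt0//.
  by rewrite le_max lexx orbT.
apply: ge0_le_integral => //.
- by move=> x _; rewrite lee_fin mulr_ge0 ?expR_ge0 ?powR_ge0.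
- exact: Gamma_integrand_measurable.
- exact: Gamma_integrand_measurable.
- move=> x/=; rewrite in_itv/= => x01.
  by rewrite lee_fin ler_wpM2l ?expR_ge0// ger_powR// lerD2r ltW.
Qed.

Lemma integral_if (R : realType) d (T : measurableType d)
    (mu : {measure set T -> \bar R}) (b : T -> bool) (f : T -> \bar R) :
  (\int[mu]_x (if b x then f x else 0) = \int[mu]_(x in [set x | b x]) f x)%E.
Proof.
rewrite [RHS]integral_mkcond; apply: eq_integral => x _.
by rewrite patchE; congr (if _ then _ else _); apply/idP/idP; rewrite inE.
Qed.

(* [1 - exp (- m x)] is the integral of [exp (- v)] over [0 < v <= m x];
   exchanging the integrals leaves the Gamma integral, scaled. *)
Lemma integral_stable_laplace (R : realType) (alpha m : R) :
  0 < alpha -> 0 < m ->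
  (\int[lebesgue_measure]_(x in `]0%R, +oo[)
     ((1 - expR (- (m * x))) * (alpha * x `^ (- alpha - 1)))%:E =
   (m `^ alpha)%:E * Gamma (1 - alpha))%E.
Proof.
move=> a0 m0.
pose b (z : R * R) := (0 < z.1) && ((0 < z.2) && (z.2 <= m * z.1)).
pose f (z : R * R) : \bar R :=
  if b z then (expR (- z.2) * (alpha * z.1 `^ (- alpha - 1)))%:E else 0%E.
have mb : measurable_fun setT b.
  apply: measurable_and; first exact: measurable_fun_ltr.
  apply: measurable_and; first exact: measurable_fun_ltr.
  by apply: measurable_fun_ler => //; exact: measurable_funM.
have mf : measurable_fun setT f.
  apply: measurable_fun_ifT => //; apply/measurable_EFinP.
  apply: measurable_funM.
    by do 2!apply: measurableT_comp => //.
  apply: measurable_funM => //.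
  by apply: (measurableT_comp (measurable_powR _)).
have f0 z : (0 <= f z)%E.
  rewrite /f; case: ifP => // _.
  by rewrite lee_fin !mulr_ge0 ?expR_ge0 ?powR_ge0// ltW.
transitivity (\int[lebesgue_measure]_x \int[lebesgue_measure]_v f (x, v))%E.
  rewrite [LHS]integral_mkcond; apply: eq_integral => x _.
  rewrite patchE; case: ifPn => [|xD].
    rewrite inE/= in_itv/= andbT => x0.
    have mx0 : 0 < m * x by rewrite mulr_gt0.
    rewrite EFinM -integral_expRN// -ge0_integralZr//.
    - transitivity (\int[lebesgue_measure]_v
        (if ((0 < v) && (v <= m * x))%R then
         (expR (- v))%:E * (alpha * x `^ (- alpha - 1))%:E else 0))%E.
        by rewrite integral_if; congr (integral _ _ _).
      by apply: eq_integral => v _; rewrite /f /b/= x0/= EFinM.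
    - exact: expRN_measurable.
    - by rewrite lee_fin mulr_ge0 ?powR_ge0// ltW.
  rewrite integral0_eq// => v _; rewrite /f /b/=.
  case: ltP => //= x0; exfalso; move/negP: xD; apply.
  by rewrite inE/= in_itv/= x0.
transitivity (\int[lebesgue_measure]_v \int[lebesgue_measure]_x f (x, v))%E.
  exact: fubini_tonelli.
have mg : measurable_fun (`]0, +oo[%classic : set R)
    (fun x : R => (expR (- x) * x `^ (1 - alpha - 1))%:E).
  exact: Gamma_integrand_measurable.
rewrite /Gamma -ge0_integralZl//; last 2 first.
- by move=> x _; rewrite lee_fin mulr_ge0 ?expR_ge0 ?powR_ge0.
- by rewrite lee_fin powR_ge0.
rewrite [RHS]integral_mkcond; apply: eq_integral => v _.
rewrite patchE; case: ifPn => [|vD]; last first.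
  rewrite integral0_eq// => x _; rewrite /f /b/=.
  case: (ltP 0 v) => //= v0; last by rewrite andbF.
  exfalso; move/negP: vD; apply.
  by rewrite inE/= in_itv/= v0.
rewrite inE/= in_itv/= andbT => v0.
have vm0 : 0 < v / m by rewrite divr_gt0.
transitivity (\int[lebesgue_measure]_x
    (if (v / m <= x)%R then
     (expR (- v) * alpha)%:E * (x `^ (- alpha - 1))%:E else 0))%E.
  apply: eq_integral => x _; rewrite /f /b/= v0/= ler_pdivrMr// (mulrC x).
  case: (leP v (m * x)) => [vx|_]; last by rewrite andbF.
  rewrite ifT ?andbT -?EFinM ?mulrA//.
  by rewrite -(pmulr_rgt0 _ m0); exact: lt_le_trans vx.
rewrite integral_if.
have -> : [set x : R | v / m <= x] = `[v / m, +oo[%classic.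
  by apply/seteqP; split => x /=; rewrite in_itv/= andbT.
rewrite ge0_integralZl//; last 3 first.
- apply/measurable_EFinP; apply: measurable_funTS; exact: measurable_powR.
- by move=> x _; rewrite lee_fin powR_ge0.
- by rewrite lee_fin mulr_ge0 ?expR_ge0// ltW.
rewrite integral_powR_itvcy// -!EFinM; congr EFin.
have -> : 1 - alpha - 1 = - alpha by ring.
rewrite powRM ?invr_ge0 ?ltW//.
have -> : m^-1 `^ (- alpha) = m `^ alpha.
  rewrite -powR_inv1 ?ltW// -powRrM; congr (_ `^ _); ring.
by field; rewrite gt_eqF.
Qed.

(** The factor [alpha] normalises the measure so that [[1, +oo[] has mass 1; cuts [b] close to 1
    then have mass close to 1. *)
Lemma integral_stable_tail (R : realType) (alpha b : R) :
  0 < alpha -> 0 < b ->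
  (\int[lebesgue_measure]_(x in `[b, +oo[) (alpha * x `^ (- alpha - 1))%:E =
   (b `^ (- alpha))%:E)%E.
Proof.
move=> a0 b0; under eq_integral do rewrite EFinM.
rewrite ge0_integralZl//; last 3 first.
- apply/measurable_EFinP; apply: measurable_funTS; exact: measurable_powR.
- by move=> x _; rewrite lee_fin powR_ge0.
- by rewrite lee_fin ltW.
by rewrite integral_powR_itvcy// -EFinM mulrC divfK ?gt_eqF.
Qed.

(** * Tauberian theorem *)

(* The integral of [(1 - z) p(z)] when [1 - z^m] has integral [a m] for all [m]. *)
Definition poly_moment (R : realType) (a : nat -> R) (p : {poly R}) : R :=
  \sum_(i < size p) p`_i * (a i.+1 - a i).

Lemma poly_momentZ (R : realType) (c : R) (a : nat -> R) (p : {poly R}) :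
  poly_moment (fun i => c * a i) p = c * poly_moment a p.
Proof.
rewrite /poly_moment mulr_sumr; apply: eq_bigr => i _; ring.
Qed.

Lemma poly_moment_widen (R : realType) (n : nat) (a : nat -> R) (p : {poly R}) :
  (size p <= n)%N -> poly_moment a p = \sum_(i < n) p`_i * (a i.+1 - a i).
Proof.
move=> pn; rewrite /poly_moment (big_ord_widen _ (fun i => p`_i * (a i.+1 - a i)) pn).
rewrite big_mkcond/=; apply: eq_bigr => i _; case: ltnP => // ip.
by rewrite nth_default// mul0r.
Qed.

(** Telescoping: [(1 - z) z^i = (1 - z^(i+1)) - (1 - z^i)], a difference of integrable functions
    even when the measure is infinite. The weight [w] lets the same statement serve the stable
    density and, with [w = 1], the law of [X]. *)
Lemma integral_poly_moment d (T : measurableType d) (R : realType)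
    (mu : {measure set T -> \bar R}) (D : set T) (Z w : T -> R) (a : nat -> R)
    (p : {poly R}) :
  measurable D ->
  (forall m, mu.-integrable D (fun x => ((1 - Z x ^+ m) * w x)%:E)) ->
  (forall m, \int[mu]_(x in D) ((1 - Z x ^+ m) * w x)%:E = (a m)%:E)%E ->
  mu.-integrable D (fun x => ((1 - Z x) * p.[Z x] * w x)%:E) /\
  (\int[mu]_(x in D) ((1 - Z x) * p.[Z x] * w x)%:E = (poly_moment a p)%:E)%E.
Proof.
move=> mD iZ aZ.
pose f m x := ((1 - Z x ^+ m) * w x)%:E.
have fE x : ((1 - Z x) * p.[Z x] * w x)%:E =
    (\sum_(i < size p) (p`_i)%:E * ((f i.+1 \- f i) x))%E.
  rewrite horner_coef mulrAC mulr_sumr sumEFin; congr EFin.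
  by apply: eq_bigr => i _; rewrite exprS; ring.
have iB i : mu.-integrable D (f i.+1 \- f i)%E by apply: integrableB => //; exact: iZ.
have ipB (i : 'I_(size p)) :
    mu.-integrable D (fun x => (p`_i)%:E * ((f i.+1 \- f i) x))%E.
  exact: integrableZl.
split.
  apply: (@eq_integrable _ _ _ _ D mD
    (fun x => \sum_(i < size p) (p`_i)%:E * ((f i.+1 \- f i) x))%E).
    by move=> x _; rewrite fE.
  exact: integrable_sum.
under eq_integral do rewrite fE.
rewrite integral_sum// /poly_moment -sumEFin; apply: eq_bigr => i _.
rewrite integralZl// integralB; [|exact: mD|exact: iZ|exact: iZ].
by rewrite /f !aZ.
Qed.

Lemma integrable_ge0_EFin d (T : measurableType d) (R : realType)
    (mu : {measure set T -> \bar R}) (D : set T) (f : T -> R) (r : R) :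
  measurable_fun D (EFin \o f) -> (forall x, D x -> 0 <= f x) ->
  (\int[mu]_(x in D) (f x)%:E = r%:E)%E -> mu.-integrable D (EFin \o f).
Proof.
move=> mf f0 fr; apply/integrableP; split => //.
rewrite (eq_integral (EFin \o f)); first by rewrite fr ltry.
by move=> x; rewrite inE => Dx; rewrite /= ger0_norm// f0.
Qed.

(** * The stable limit measure: moments against tails *)

Section stable_measure.
Variables (R : realType) (alpha : R).
Hypothesis a01 : 0 < alpha < 1.

Let w (x : R) := alpha * x `^ (- alpha - 1).
Let g : R := fine (Gamma (1 - alpha)).
Let mu := (@lebesgue_measure R).
Let D : set R := `]0, +oo[.

Let mD : measurable D. Proof. exact: measurable_itv. Qed.

Let a0 : 0 < alpha. Proof. by case/andP : a01. Qed.

Lemma Gamma_fin : Gamma (1 - alpha) \is a fin_num.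
Proof.
have /andP[? ?] := a01.
rewrite ge0_fin_numE; first by apply: le_lt_trans (Gamma_le1 _ _) (ltry _); lra.
by apply: ltW; apply: Gamma_gt0; lra.
Qed.

Lemma fine_Gamma_gt0 : 0 < g.
Proof.
have /andP[? ?] := a01.
by rewrite -lte_fin fineK ?Gamma_fin//; apply: Gamma_gt0; lra.
Qed.

Let w0 x : 0 <= w x. Proof. by rewrite mulr_ge0 ?powR_ge0// ltW. Qed.

Let mw (E : set R) : measurable_fun E w.
Proof. by apply: measurable_funTS; apply: measurable_funM => //; exact: measurable_powR. Qed.

Let mZ (m : nat) (E : set R) :
  measurable_fun E (EFin \o (fun x => (1 - expR (- x) ^+ m) * w x)).
Proof.
apply/measurable_EFinP; apply: measurable_funM => //.
apply: measurable_funTS; apply: measurable_funB => //.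
apply: measurable_funX; apply: measurableT_comp; last exact: oppr_measurable.
exact: measurable_expR.
Qed.

Lemma stable_moment (m : nat) :
  (\int[mu]_(x in D) ((1 - expR (- x) ^+ m) * w x)%:E =
   (m%:R `^ alpha * g)%:E)%E.
Proof.
case: m => [|m].
  rewrite powR0 ?gt_eqF// mul0r integral0_eq// => x _.
  by rewrite expr0 subrr mul0r.
rewrite EFinM fineK ?Gamma_fin// -integral_stable_laplace//.
apply: eq_integral => x _; congr ((1 - _) * _)%:E.
by rewrite -expRM_natl mulrN.
Qed.

Lemma stable_moment_integrable (m : nat) :
  mu.-integrable D (fun x => ((1 - expR (- x) ^+ m) * w x)%:E).
Proof.
apply: integrable_ge0_EFin (stable_moment m); first exact: mZ.
move=> x; rewrite /D/= in_itv/= andbT => x0; rewrite mulr_ge0// subr_ge0.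
by rewrite exprn_ile1 ?expR_ge0// -expR0 ler_expR oppr_le0 ltW.
Qed.

Let stable_tail (B : set R) (b c : R) : measurable B -> B `<=` D ->
  (\int[mu]_(x in B) (w x)%:E = (b `^ (- alpha))%:E)%E ->
  mu.-integrable D (fun x => ((\1_B x + c * (1 - expR (- x))) * w x)%:E) /\
  (\int[mu]_(x in D) ((\1_B x + c * (1 - expR (- x))) * w x)%:E =
   (b `^ (- alpha) + c * g)%:E)%E.
Proof.
move=> mB BD wB.
have i1 := stable_moment_integrable 1.
have i1' : mu.-integrable D (fun x => c%:E * ((1 - expR (- x) ^+ 1) * w x)%:E)%E.
  by apply: integrableZl => //; exact: i1.
have EB : (\int[mu]_(x in D) (\1_B x * w x)%:E = (b `^ (- alpha))%:E)%E.
  rewrite -wB integral_mkcond [RHS]integral_mkcond; apply: eq_integral => x _.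
  rewrite !patchE indicE; case: (boolP (x \in B)) => [xB|_].
    by rewrite mul1r mem_set//; apply: BD; rewrite inE in xB.
  by rewrite mul0r; case: ifP.
have iB : mu.-integrable D (EFin \o (fun x => \1_B x * w x)).
  apply: integrable_ge0_EFin EB.
    apply/measurable_EFinP; apply: measurable_funM; last exact: mw.
    exact: measurable_indic.
  by move=> x _; rewrite mulr_ge0.
have E x : ((\1_B x + c * (1 - expR (- x))) * w x)%:E =
    ((\1_B x * w x)%:E + c%:E * ((1 - expR (- x) ^+ 1) * w x)%:E)%E.
  by rewrite -EFinM -EFinD; congr EFin; rewrite expr1; ring.
split.
  by apply: eq_integrable (integrableD _ iB i1') => // x _; rewrite E.
under eq_integral do rewrite E.
rewrite integralD// EB integralZl// stable_moment.
by rewrite powR1 mul1r.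
Qed.

(** With [z = exp (- x)], the condition [z <= exp (- b)] reads [x >= b], a set of mass
    [b^(- alpha)]. The error [e (1 - z)] has the finite integral [e g], whereas a constant error
    would have an infinite one. *)
Lemma stable_poly_upper (p : {poly R}) (b e : R) : 0 < b ->
  (forall z, 0 <= z <= 1 ->
    (1 - z) * p.[z] <= (z <= expR (- b))%R%:R + e * (1 - z)) ->
  poly_moment (fun m => m%:R `^ alpha) p * g <= b `^ (- alpha) + e * g.
Proof.
move=> b0 pb.
have BD : `[b, +oo[ `<=` D.
  by move=> x; rewrite /D/= !in_itv/= !andbT; exact: lt_le_trans.
have [i1 E1] := @integral_poly_moment _ (measurableTypeR R) R mu D _ _ _ p mD
  stable_moment_integrable stable_moment.
have [i2 E2] := @stable_tail _ b e (measurable_itv _) BD (integral_stable_tail a0 b0).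
have : (\int[mu]_(x in D) ((1 - expR (- x)) * p.[expR (- x)] * w x)%:E <=
  \int[mu]_(x in D) ((\1_(`[b, +oo[) x + e * (1 - expR (- x))) * w x)%:E)%E.
  apply: le_integral => // x; rewrite inE /D/= in_itv/= andbT => x0.
  rewrite lee_fin ler_wpM2r//.
  have := pb (expR (- x)); rewrite ler_expR lerN2 expR_ge0 -expR0 ler_expR.
  rewrite oppr_le0 (ltW x0) => /(_ isT); rewrite expR0 indicE.
  by rewrite mem_setE in_itv/= andbT.
rewrite E1 E2 lee_fin; apply: le_trans.
by rewrite mulrC -poly_momentZ; under eq_fun do rewrite mulrC.
Qed.

Lemma stable_poly_lower (p : {poly R}) (b e : R) : 0 < b ->
  (forall z, 0 <= z <= 1 ->
    (z < expR (- b))%R%:R - e * (1 - z) <= (1 - z) * p.[z]) ->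
  b `^ (- alpha) - e * g <= poly_moment (fun m => m%:R `^ alpha) p * g.
Proof.
move=> b0 pb.
have BD : `]b, +oo[ `<=` D.
  by move=> x; rewrite /D/= !in_itv/= !andbT; exact: lt_trans.
have [i1 E1] := @integral_poly_moment _ (measurableTypeR R) R mu D _ _ _ p mD
  stable_moment_integrable stable_moment.
have wB : (\int[mu]_(x in `]b, +oo[) (w x)%:E = (b `^ (- alpha))%:E)%E.
  rewrite integral_itv_obnd_cbnd ?integral_stable_tail//.
  exact/measurable_EFinP.
have [i2 E2] := @stable_tail _ b (- e) (measurable_itv _) BD wB.
have : (\int[mu]_(x in D) ((\1_(`]b, +oo[) x + (- e) * (1 - expR (- x))) * w x)%:E <=
   \int[mu]_(x in D) ((1 - expR (- x)) * p.[expR (- x)] * w x)%:E)%E.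
  apply: le_integral => // x; rewrite inE /D/= in_itv/= andbT => x0.
  rewrite lee_fin ler_wpM2r//.
  have := pb (expR (- x)); rewrite ltr_expR ltrN2 expR_ge0 -expR0 ler_expR.
  rewrite oppr_le0 (ltW x0) => /(_ isT); rewrite expR0 indicE.
  by rewrite mem_setE in_itv/= andbT mulNr.
rewrite E1 E2 lee_fin mulNr => /le_trans; apply.
by rewrite mulrC -poly_momentZ; under [X in poly_moment X]eq_fun do rewrite mulrC.
Qed.

End stable_measure.

Lemma prob_fine d (T : measurableType d) (R : realType) (P : probability T R)
    (A : set T) : measurable A -> P A = (fine (P A))%:E.
Proof. by move=> mA; rewrite fineK// fin_num_measure. Qed.

Lemma integral_cst1 d (T : measurableType d) (R : realType) (P : probability T R) :
  (\int[P]_w (cst 1%E w) = 1)%E.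
Proof. by rewrite integral_cst// mul1e; exact: probability_setT. Qed.

(** * From the Laplace transform near 0 to the tail *)

Section tauberian.
Variables (R : realType) (d : measure_display) (T : measurableType d).
Variables (P : probability T R) (X : T -> R).
Hypotheses (mX : measurable_fun setT X) (X0 : forall w, 0 <= X w).

Let tail (y : R) : R := fine (P [set w | y < X w]).

Let laplace (s : R) : R := fine (\int[P]_w (expR (- (s * X w)))%:E)%E.

Let mtail y : measurable [set w | y < X w].
Proof.
rewrite -[X in measurable X]setTI.
exact: (measurable_fun_ltr (measurable_cst y) mX).
Qed.

Let mexp (s : R) : measurable_fun setT (fun w => expR (- (s * X w))).
Proof.
apply: measurableT_comp; first exact: measurable_expR.
apply: measurableT_comp; first exact: oppr_measurable.
exact: measurable_funM.
Qed.

Let exp01 (s : R) w : 0 <= s -> 0 <= expR (- (s * X w)) <= 1.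
Proof.
by move=> s0; rewrite expR_ge0/= -expR0 ler_expR oppr_le0 mulr_ge0.
Qed.

Let iexp (s : R) : 0 <= s ->
  P.-integrable setT (fun w => (expR (- (s * X w)))%:E).
Proof.
move=> s0; apply: (le_integrable measurableT (g := EFin \o cst 1));
  last exact: finite_measure_integrable_cst.
  exact/measurable_EFinP.
move=> w _; have /andP[h0 h1] := exp01 w s0.
by rewrite /= lee_fin normr1 ger0_norm.
Qed.

Let laplaceE (s : R) : 0 <= s ->
  (\int[P]_w (expR (- (s * X w)))%:E = (laplace s)%:E)%E.
Proof. by move=> s0; rewrite fineK//; exact: (integrable_fin_num measurableT (iexp s0)). Qed.

Let laplace0 : laplace 0 = 1.
Proof.
rewrite -[RHS]/(fine 1) -(integral_cst1 P) /laplace; congr fine; apply: eq_integral => w _.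
by rewrite mul0r oppr0 expR0.
Qed.

Let moments (s : R) (m : nat) : 0 <= s ->
  P.-integrable setT
    (fun w => ((1 - expR (- (s * X w)) ^+ m) * cst 1 w)%:E) /\
  (\int[P]_w ((1 - expR (- (s * X w)) ^+ m) * cst 1 w)%:E =
   (1 - laplace (m%:R * s))%:E)%E.
Proof.
move=> s0.
have E w : ((1 - expR (- (s * X w)) ^+ m) * cst 1 w)%:E =
    ((cst 1 w)%:E - (expR (- (m%:R * s * X w)))%:E)%E.
  by rewrite mulr1 EFinB -expRM_natl mulrN mulrA.
have ms0 : 0 <= m%:R * s by rewrite mulr_ge0.
split.
  apply: (@eq_integrable _ _ _ P setT measurableT
    ((EFin \o cst 1%R) \- (fun w => (expR (- (m%:R * s * X w)%R))%:E))%E).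
    by move=> w _; rewrite E.
  apply: integrableB => //; last exact: iexp.
  exact: finite_measure_integrable_cst.
under eq_integral do rewrite E.
rewrite integralB_EFin//; [|exact: finite_measure_integrable_cst|exact: iexp].
by rewrite laplaceE// integral_cst1 EFinB.
Qed.

Let poly_laplace (s : R) (p : {poly R}) : 0 <= s ->
  P.-integrable setT
    (fun w => ((1 - expR (- (s * X w))) * p.[expR (- (s * X w))])%:E) /\
  (\int[P]_w ((1 - expR (- (s * X w))) * p.[expR (- (s * X w))])%:E =
   (poly_moment (fun m => 1 - laplace (m%:R * s)) p)%:E)%E.
Proof.
move=> s0.
have [] := @integral_poly_moment _ T R P setT
  (fun w => expR (- (s * X w))) (cst 1) _ p measurableT
  (fun m => (moments m s0).1) (fun m => (moments m s0).2).
have E w : ((1 - expR (- (s * X w))) * p.[expR (- (s * X w))] * cst 1 w)%:E =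
  ((1 - expR (- (s * X w))) * p.[expR (- (s * X w))])%:E by rewrite mulr1.
move=> i1; under eq_integral do rewrite E; move=> ->; split => //.
by apply: eq_integrable i1 => // w _; rewrite E.
Qed.

Let tailE (y : R) :
  P.-integrable setT (fun w => (\1_[set w | y < X w] w)%:E) /\
  (\int[P]_w (\1_[set w | y < X w] w)%:E = (tail y)%:E)%E.
Proof.
split.
  apply: (le_integrable measurableT (g := EFin \o cst 1));
  last exact: finite_measure_integrable_cst.
    by apply/measurable_EFinP; exact: measurable_indic.
  by move=> w _; rewrite /= lee_fin normr1 indicE normr_nat lern1 leq_b1.
by rewrite integral_indic// setIT; exact: prob_fine.
Qed.

(** At [z = exp (- s X)] the event [z < exp (- 1)] is exactly [X > 1 / s]. *)
Let tail_le (s : R) (p : {poly R}) : 0 < s ->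
  (forall z, 0 <= z <= 1 -> (z < expR (- 1))%R%:R <= (1 - z) * p.[z]) ->
  tail s^-1 <= poly_moment (fun m => 1 - laplace (m%:R * s)) p.
Proof.
move=> s0 pP; have [i1 E1] := tailE s^-1; have [i2 E2] := poly_laplace p (ltW s0).
rewrite -lee_fin -E1 -E2; apply: le_integral => // w _.
rewrite lee_fin; apply: le_trans (pP _ (exp01 w (ltW s0))).
rewrite indicE ltr_expR ltrN2 -ltr_pdivrMl// mulr1.
by rewrite ler_nat; case: (boolP (_ \in _)) => //; rewrite inE/= => ->.
Qed.

(** The event [z <= exp (- b)] reads [s X >= b]; the gap [b > 1] turns this weak inequality into the
    strict [X > 1 / s]. *)
Let tail_ge (s b : R) (p : {poly R}) : 0 < s -> 1 < b ->
  (forall z, 0 <= z <= 1 -> (1 - z) * p.[z] <= (z <= expR (- b))%R%:R) ->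
  poly_moment (fun m => 1 - laplace (m%:R * s)) p <= tail s^-1.
Proof.
move=> s0 b1 pP; have [i1 E1] := tailE s^-1; have [i2 E2] := poly_laplace p (ltW s0).
rewrite -lee_fin -E1 -E2; apply: le_integral => // w _.
rewrite lee_fin; apply: le_trans (pP _ (exp01 w (ltW s0))) _.
rewrite indicE ler_expR lerN2 ler_nat.
case: (leP b) => // bX; rewrite mem_set//= -[ltLHS]mulr1 ltr_pdivrMl//.
exact: lt_le_trans bX.
Qed.

Variables (alpha C : R).
Hypothesis a0 : 0 < alpha.
Hypothesis lapC : s `^ (- alpha) * (1 - laplace s) @[s --> 0^'+] --> C.

(** For [m > 0] the hypothesis is used at [m s], and [m^alpha] compensates the change of
    normalisation. For [m = 0] both sides vanish because [laplace 0 = 1]. *)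
Let moment_cvg (m : nat) :
  s `^ (- alpha) * (1 - laplace (m%:R * s)) @[s --> 0^'+] --> C * m%:R `^ alpha.
Proof.
case: m => [|m].
  rewrite powR0 ?gt_eqF// mulr0.
  under eq_fun do rewrite mul0r laplace0 subrr mulr0.
  exact: cvg_cst.
have m0 : 0 < m.+1%:R :> R by [].
apply: (@cvg_trans _ (((m.+1%:R * s) `^ (- alpha) * (1 - laplace (m.+1%:R * s))) *
    m.+1%:R `^ alpha @[s --> 0^'+])).
  apply: near_eq_cvg; near=> s.
  have s0 : 0 < s by [].
  rewrite powRM ?ltW// mulrAC (mulrC (_.+1%:R `^ _)) -(mulrA (s `^ _)) -powRD.
    by rewrite addNr powRr0 mulr1.
  by apply/implyP => _; rewrite gt_eqF.
apply: cvgM; last exact: cvg_cst.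
apply: (@cvg_comp _ _ _ (fun s => m.+1%:R * s) _ _ _ _ _ lapC).
apply: cvg_at_right0; first by near=> s; rewrite mulr_gt0.
rewrite -[X in _ --> X](mulr0 m.+1%:R); apply: cvgM; first exact: cvg_cst.
exact: cvg_within.
Unshelve. all: by end_near. Qed.

Let poly_moment_cvg (p : {poly R}) :
  s `^ (- alpha) * poly_moment (fun m => 1 - laplace (m%:R * s)) p @[s --> 0^'+]
  --> C * poly_moment (fun m => m%:R `^ alpha) p.
Proof.
under eq_fun do rewrite -poly_momentZ.
rewrite -poly_momentZ /poly_moment; apply: cvg_big => [|i _].
  exact: add_continuous.
apply: cvgM; first exact: cvg_cst.
by apply: cvgB; exact: moment_cvg.
Qed.

Let C0 : 0 <= C.
Proof.
apply: (cvgr_to_ge lapC); near=> s.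
have s0 : 0 < s by [].
have s0' := ltW s0.
rewrite mulr_ge0 ?powR_ge0// subr_ge0 -lee_fin -laplaceE// -(integral_cst1 P).
apply: le_integral => //; first exact/iexp/ltW.
  exact: finite_measure_integrable_cst.
by move=> w _; rewrite lee_fin; case/andP : (exp01 w (ltW s0)).
Unshelve. all: by end_near. Qed.

Lemma tail_asymptotics_lt1 : alpha < 1 ->
  s `^ (- alpha) * tail s^-1 @[s --> 0^'+] --> C / fine (Gamma (1 - alpha)).
Proof.
move=> a1; have a01 : 0 < alpha < 1 by rewrite a0.
have := fine_Gamma_gt0 a01; set g := fine _ => g0.
(* [K] is the multiple of the stable measure with the right moments: [C m^alpha = K (m^alpha g)]. *)
pose K := C / g; have K0 : 0 <= K by rewrite divr_ge0// ltW.
have CK : C = K * g by rewrite /K divfK// gt_eqF.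
have one (h : R -> R) : h 0 = 1 -> {for 0, continuous h} ->
    (h e) `^ (- alpha) @[e --> 0^'+] --> (1 : R).
  move=> h0 ch; apply: cvg_at_right_filter.
  rewrite [X in _ --> X](_ : _ = h 0 `^ (- alpha)); last by rewrite h0 powR1.
  apply: (@cvg_comp _ _ _ h (fun y : R => y `^ (- alpha)) _ (nbhs (h 0))) => //.
  by rewrite h0; apply: powR_continuous.
have h1 : K * ((1 - e) `^ (- alpha) + e * g) @[e --> 0^'+] --> K.
  rewrite -[X in _ --> X]mulr1 -[X in _ --> K * X]addr0 -[X in _ --> K * (_ + X)](mul0r g).
  apply: cvgM; first exact: cvg_cst.
  apply: cvgD; last by apply: cvgM; [exact: cvg_within|exact: cvg_cst].
  apply: (one (fun e => 1 - e)); first by rewrite subr0.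
  by apply: cvgB; [exact: cvg_cst|exact: cvg_id].
have h2 : K * ((1 + 2 * e) `^ (- alpha) - e * g) @[e --> 0^'+] --> K.
  rewrite -[X in _ --> X]mulr1 -[X in _ --> K * X]subr0 -[X in _ --> K * (_ - X)](mul0r g).
  apply: cvgM; first exact: cvg_cst.
  apply: cvgB; last by apply: cvgM; [exact: cvg_within|exact: cvg_cst].
  apply: (one (fun e => 1 + 2 * e)); first by rewrite mulr0 addr0.
  by apply: cvgD; [exact: cvg_cst|apply: cvgM; [exact: cvg_cst|exact: cvg_id]].
apply/cvgrPdist_le => eps eps0.
(* The two expressions bound, from above and below, the limits obtained from the polynomials [p] and
   [q] below: the mass beyond the cut [1 - e] or [1 + 2 e], corrected by the approximation error
   [e g]. *)
have [e /and4P[e0 e1 he1 he2]] : exists e, [&& 0 < e, e < 1,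
    K * ((1 - e) `^ (- alpha) + e * g) < K + eps &
    K - eps < K * ((1 + 2 * e) `^ (- alpha) - e * g)].
  near (0 : R)^'+ => e; exists e; apply/and4P; split.
  - by [].
  - by near: e; exact: nbhs_right_lt.
  - by near: e; apply: (cvgr_lt K) => //; rewrite ltrDl.
  - by near: e; apply: (cvgr_gt K) => //; rewrite gtrBl.
have [p pP] : exists p : {poly R}, forall z, 0 <= z <= 1 ->
    (z < expR (- 1))%R%:R <= (1 - z) * p.[z] <=
    (z <= expR (- (1 - e)))%R%:R + e * (1 - z).
  apply: step_poly_above; rewrite ?expR_gt0// ?ltr_expR; first by lra.
  by rewrite -[ltRHS]expR0 ltr_expR; lra.
(* Both cuts lie beyond 1: [tail_ge] requires this of the inner one, [1 + e], and the outer one,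
   [1 + 2 e], leaves room for the ramp. *)
have [q qP] : exists p : {poly R}, forall z, 0 <= z <= 1 ->
    (z < expR (- (1 + 2 * e)))%R%:R - e * (1 - z) <= (1 - z) * p.[z] <=
    (z <= expR (- (1 + e)))%R%:R.
  apply: step_poly_below; rewrite ?expR_gt0// ?ltr_expR; first by lra.
  by rewrite -[ltRHS]expR0 ltr_expR; lra.
have pu : C * poly_moment (fun m => m%:R `^ alpha) p < K + eps.
  apply: le_lt_trans he1; rewrite CK -mulrA ler_wpM2l// mulrC.
  apply: stable_poly_upper => //; first by lra.
  by move=> z /pP/andP[].
have ql : K - eps < C * poly_moment (fun m => m%:R `^ alpha) q.
  apply: lt_le_trans he2 _; rewrite CK -mulrA ler_wpM2l// [leRHS]mulrC.
  apply: stable_poly_lower => //; first by lra.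
  by move=> z /qP/andP[].
have nu := cvgr_lt _ (@poly_moment_cvg p) _ pu.
have nl := cvgr_gt _ (@poly_moment_cvg q) _ ql.
near=> s.
have s0 : 0 < s by [].
have up : s `^ (- alpha) * tail s^-1 < K + eps.
  apply: (@le_lt_trans _ _
    (s `^ (- alpha) * poly_moment (fun m => 1 - laplace (m%:R * s)) p)).
    rewrite ler_wpM2l ?powR_ge0//; apply: tail_le => // z /pP/andP[//].
  by near: s; exact: nu.
have lo : K - eps < s `^ (- alpha) * tail s^-1.
  apply: (@lt_le_trans _ _
    (s `^ (- alpha) * poly_moment (fun m => 1 - laplace (m%:R * s)) q)).
    by near: s; exact: nl.
  rewrite ler_wpM2l ?powR_ge0//; apply: (@tail_ge _ (1 + e)) => //; first by lra.
  by move=> z /qP/andP[].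
by rewrite distrC ler_distl !ltW.
Unshelve. all: by end_near. Qed.

(* A multiple of [(1 - z)^2] dominates the indicator of [z < exp (- 1)], and its
   double zero at [z = 1] makes its limit moment vanish when [alpha = 1]. *)
Lemma tail_asymptotics1 : alpha = 1 ->
  s `^ (- alpha) * tail s^-1 @[s --> 0^'+] --> (0 : R).
Proof.
move=> a1; pose c := (1 - expR (- 1)) ^- 2 : R.
have e1 : 0 < 1 - expR (- 1) :> R.
  by rewrite subr_gt0 -expR0 ltr_expR oppr_lt0.
have c0 : 0 <= c by rewrite invr_ge0 exprn_ge0// ltW.
pose p : {poly R} := c *: (1 - 'X).
(* Up to the factor [- c] this is the second difference of [a] at 0, hence zero for [a m = m]. *)
have pm (a : nat -> R) : poly_moment a p = c * (a 1%N - a 0%N - (a 2%N - a 1%N)).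
  rewrite (@poly_moment_widen _ 2); last first.
    rewrite (leq_trans (size_scale_leq _ _))// -opprB size_polyN.
    by rewrite (_ : 1 = 1%:P)// size_XsubC.
  by rewrite 2!big_ord_recl big_ord0 /p !coefE /=; ring.
have pP z : 0 <= z <= 1 -> (z < expR (- 1))%R%:R <= (1 - z) * p.[z].
  move=> /andP[z0 z1]; have -> : p.[z] = c * (1 - z) by rewrite /p hornerZ !hornerE.
  case: ltP => [ze|_]; last by rewrite mulr_ge0 ?mulr_ge0// subr_ge0.
  rewrite mulrCA -expr2 /c mulrC ler_pdivlMr ?exprn_gt0// mul1r.
  by rewrite ler_sqr ?nnegrE ?(ltW e1) ?subr_ge0// lerD2l lerN2 ltW.
have lim0 : s `^ (- alpha) * poly_moment (fun m => 1 - laplace (m%:R * s)) p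
    @[s --> 0^'+] --> (0 : R).
  rewrite [X in _ --> X](_ : _ = C * poly_moment (fun m => m%:R `^ alpha) p).
    exact: poly_moment_cvg.
  by rewrite pm a1 !powRr1//; ring.
apply: (squeeze_cvgr _ (cvg_cst 0) lim0); near=> s.
have s0 : 0 < s by [].
rewrite mulr_ge0 ?powR_ge0 ?fine_ge0//= ler_wpM2l ?powR_ge0//.
exact: tail_le.
Unshelve. all: by end_near. Qed.

End tauberian.

(** * Laplace transform of the counting process *)

Lemma integral_mrestr d (T : measurableType d) (R : realType)
    (mu : {measure set T -> \bar R}) (A : set T) (mA : measurable A)
    (f : T -> \bar R) :
  measurable_fun setT f -> (forall x, 0 <= f x)%E ->
  (\int[mrestr mu mA]_x f x = \int[mu]_(x in A) f x)%E.
Proof.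
move=> mf f0.
rewrite -(setUv A) ge0_integral_setU//; last 3 first.
- exact: measurableC.
- by rewrite setUv.
- exact/disj_setPCl.
rewrite [X in (_ + X)%E](_ : _ = 0%E); last first.
  apply: null_set_integral => //; first exact: measurableC.
    exact: measurable_funTS.
  by rewrite /= /mrestr setICl measure0.
rewrite adde0; apply: eq_measure_integral => B mB BA.
by rewrite /= /mrestr setIidl.
Qed.

(** The hypothesis says that the image under [Y] of [P] restricted to [A] is [P A] times the law of
    [Y]; both sides integrate [g] against this one measure on the line. *)
Lemma integral_indep d (T : measurableType d) (R : realType)
    (P : probability T R) (A : set T) (Y : T -> R) (g : R -> \bar R) :
  measurable A -> measurable_fun setT Y -> measurable_fun setT g ->
  (forall y, 0 <= g y)%E ->
  (forall B, measurable B -> P (A `&` Y @^-1` B) = P A * P (Y @^-1` B))%E ->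
  (\int[P]_(w in A) g (Y w) = P A * \int[P]_w g (Y w))%E.
Proof.
move=> mA mY mg g0 PAY.
have mgY : measurable_fun setT (g \o Y) by exact: measurableT_comp.
rewrite -(integral_mrestr P mA mgY); last by move=> w; exact: g0.
rewrite -(@ge0_integral_pushforward _ _ _ _ R Y mY (mrestr P mA) setT g)//.
rewrite -(@ge0_integral_pushforward _ _ _ _ R Y mY P setT g)//.
have PA0 : (0 <= fine (P A))%R by exact: fine_ge0.
have PAE : P A = (fine (P A))%:E by rewrite fineK// fin_num_measure.
rewrite [in RHS]PAE.
rewrite -[fine (P A)]/((NngNum PA0)%:num) -ge0_integral_mscale//.
apply: eq_measure_integral => B mB _.
transitivity (P (Y @^-1` B `&` A)) => //.
transitivity ((fine (P A))%:E * P (Y @^-1` B))%E => //.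
by rewrite setIC PAY// -PAE.
Qed.

(* [ln (f s)] is [s] times the slope [ln (f h) / h] at [h = s / n], for every [n]. *)
Lemma semigroup_exp (R : realType) (f : R -> R) (c : R) :
  f 0 = 1 -> (forall s h, 0 <= s -> 0 <= h -> f (s + h) = f s * f h) ->
  (f h - 1) / h @[h --> 0^'+] --> - c ->
  forall s, 0 <= s -> f s = expR (- (s * c)).
Proof.
move=> f0 fD fc s; rewrite le_eqVlt => /predU1P[<-|s0].
  by rewrite mul0r oppr0 expR0 f0.
(* A finite slope at 0 forces [f h] to tend to 1, so [f] is positive near 0 and its logarithm is
   meaningful there. *)
have f1 : f h @[h --> 0^'+] --> (1 : R).
  rewrite -[X in _ --> X]addr0 -[X in _ --> _ + X](mul0r (- c)).
  apply: (@cvg_trans _ (1 + h * ((f h - 1) / h) @[h --> 0^'+])).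
    apply: near_eq_cvg; near=> h; have h0 : 0 < h by [].
    by field; rewrite gt_eqF.
  apply: cvgD; first exact: cvg_cst.
  by apply: cvgM => //; exact: cvg_within.
have fpos : \forall h \near 0^'+, 0 < f h.
  by apply: (cvgr_gt _ f1); exact: ltr01.
have lnf : ln (f h) / h @[h --> 0^'+] --> - c.
  (* The slopes of [ln f] and of [f] agree by [1 - 1 / x <= ln x <= x - 1] at [x = f h]. *)
  have lo : (f h - 1) / h / f h @[h --> 0^'+] --> - c.
    rewrite -[X in _ --> X]divr1; apply: cvgM => //.
    by apply: cvgV => //; exact: oner_neq0.
  apply: (squeeze_cvgr _ lo fc); near=> h.
  have h0 : 0 < h by [].
  have fh0 : 0 < f h by near: h.
  apply/andP; split.
    rewrite mulrAC ler_pM2r ?invr_gt0// mulrBl divff ?gt_eqF// mul1r.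
    have : ln (f h)^-1 <= (f h)^-1 - 1.
      have -> : (f h)^-1 = 1 + ((f h)^-1 - 1) by ring.
      rewrite [leRHS](_ : _ = (f h)^-1 - 1); last by ring.
      by apply: le_ln1Dx; rewrite ltrBrDl subrr invr_gt0.
    by rewrite lnV ?posrE//; lra.
  rewrite ler_pM2r ?invr_gt0//.
  have -> : f h = 1 + (f h - 1) by ring.
  rewrite [leRHS](_ : _ = f h - 1); last by ring.
  by apply: le_ln1Dx; rewrite ltrBrDl subrr.
have fX n h : 0 <= h -> f (n%:R * h) = f h ^+ n.
  move=> h0; elim: n => [|n IH]; first by rewrite mul0r f0 expr0.
  by rewrite -natr1 mulrDl mul1r fD ?mulr_ge0// IH exprSr.
pose u (n : nat) : R := s / n.+1%:R.
have u0 n : 0 < u n by rewrite divr_gt0.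
have ucvg : u n @[n --> \oo] --> (0 : R)^'+.
  apply: cvg_at_right0; first exact: nearW.
  rewrite -[X in _ --> X](mulr0 s); apply: cvgM; first exact: cvg_cst.
  exact: cvg_harmonic.
have fs n : f s = f (u n) ^+ n.+1.
  by rewrite -fX ?ltW// /u mulrC divfK// pnatr_eq0.
have fs0 : 0 < f s.
  have [n /= fn] : exists n, 0 < f (u n).
    near \oo => n; exists n; near: n.
    exact: ucvg fpos.
  by rewrite (fs n) exprn_gt0.
have h1 : s * (ln (f (u n)) / u n) @[n --> \oo] --> s * - c.
  apply: cvgM; first exact: cvg_cst.
  exact: (cvg_comp _ _ ucvg lnf).
have h2 : s * (ln (f (u n)) / u n) @[n --> \oo] --> ln (f s).
  apply: (@cvg_trans _ (ln (f s) @[n --> \oo])); last exact: cvg_cst.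
  apply: near_eq_cvg; near=> n.
  have fn0 : 0 < f (u n) by near: n; exact: ucvg fpos.
  rewrite (fs n) lnXn// -[LHS]mulr_natr /u.
  have : 0 < n.+1%:R :> R by [].
  by move: (n.+1%:R : R) => m m0;field; rewrite !gt_eqF.
by rewrite -(lnK fs0) (cvg_unique _ h2 h1) ?mulrN.
Unshelve. all: by end_near. Qed.

Section nat_valued.
Variables (R : realType) (d : measure_display) (T : measurableType d).
Variables (P : probability T R) (N : T -> nat).
Hypothesis mN : forall n, measurable [set w | N w = n].

Let NT : \bigcup_n [set w | N w = n] = setT.
Proof. by apply/seteqP; split => // w _; exists (N w). Qed.

Lemma measurable_fun_levels d' (T' : measurableType d') (h : T -> T') :
  (forall n, measurable_fun [set w | N w = n] h) -> measurable_fun setT h.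
Proof. by move=> mh; rewrite -NT; apply/measurable_fun_bigcup. Qed.

Lemma integral_levels (h : T -> \bar R) :
  measurable_fun setT h -> (forall w, 0 <= h w)%E ->
  (\int[P]_w h w = \sum_(n <oo) \int[P]_(w in [set w | N w = n]) h w)%E.
Proof.
move=> mh h0; rewrite -NT ge0_integral_bigcup//; first by rewrite NT.
by move=> i j _ _ [w [/= <- <-]].
Qed.

(** Conditioning on a discrete variable: on the level [N = n] the integrand is a function of [Y n]
    alone, so it factorises there, and the levels are summed. The variable [Y n] may change with the
    level, which the random time change exploits. *)
Lemma integral_indep_nat (Y : nat -> T -> R) (g : nat -> R -> \bar R) :
  (forall n, measurable_fun setT (Y n)) ->
  (forall n, measurable_fun setT (g n)) ->
  (forall n y, 0 <= g n y)%E ->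
  (forall n B, measurable B -> P ([set w | N w = n] `&` Y n @^-1` B) =
    P [set w | N w = n] * P (Y n @^-1` B))%E ->
  (\int[P]_w g (N w) (Y (N w) w) = \int[P]_w \int[P]_v g (N w) (Y (N w) v))%E.
Proof.
move=> mY mg g0 PNY.
have level (h : nat -> T -> \bar R) : (forall n, measurable_fun setT (h n)) ->
    measurable_fun setT (fun w => h (N w) w).
  move=> mh; apply: measurable_fun_levels => n.
  apply: (eq_measurable_fun (h n)); last exact: measurable_funTS.
  by move=> w; rewrite inE/= => ->.
rewrite integral_levels//; last first.
  by apply: (level (fun n w => g n (Y n w))) => n; exact: measurableT_comp.
rewrite [RHS]integral_levels//; last 2 first.
- exact: (level (fun n _ => \int[P]_v g n (Y n v))%E).
- by move=> w; exact: integral_ge0.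
apply: eq_eseriesr => n _.
transitivity (\int[P]_(w in [set w | N w = n]) g n (Y n w))%E.
  by apply: eq_integral => w; rewrite inE/= => ->.
rewrite integral_indep//; last exact: PNY.
symmetry.
transitivity (\int[P]_(w in [set w | N w = n]) cst (\int[P]_v g n (Y n v)) w)%E.
  by apply: eq_integral => w; rewrite inE/= => ->.
by rewrite integral_cst// muleC.
Qed.

End nat_valued.

(** The exponent [sum_j lam_j (1 - u^j)] of the generating function at [u = exp (- eta)]; this is
    the [psi] of the overview. *)
Definition gcp_exponent (R : realType) (k : nat) (lam : nat -> R) (eta : R) : R :=
  \sum_(1 <= j < k.+1) lam j * (1 - expR (- (eta * j%:R))).

(** At [m = M h w] it identifies a finite combination of level indicators, whose expectation is
    explicit, with a function of [M h w] cut off outside [1, ..., k]. *)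
Lemma sum_pred1 (R : pzSemiRingType) (k m : nat) (c : nat -> R) :
  \sum_(1 <= j < k.+1) c j * (m == j)%:R = if (1 <= m <= k)%N then c m else 0.
Proof.
under eq_bigr do rewrite mulr_natr mulrb eq_sym.
by rewrite -big_mkcond/= big_nat1_eq ltnS.
Qed.

Section gcp.
Variables (R : realType) (d : measure_display) (T : measurableType d).
Variables (P : probability T R) (k : nat) (lam : nat -> R) (M : R -> T -> nat).
Hypothesis hM : is_gcp P k lam M.

Lemma gcp_measurable t : 0 <= t -> measurable_fun setT (fun w => (M t w)%:R : R).
Proof. by move=> t0; exact: (levy_measurable hM.1 t0). Qed.

Lemma gcp_level_measurable t n : 0 <= t -> measurable [set w | M t w = n].
Proof.
move=> t0; have := gcp_measurable t0 measurableT (measurable_set1 (n%:R : R)).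
rewrite setTI; congr measurable; apply/seteqP; split => w /=.
  by move=> /eqP; rewrite eqr_nat => /eqP.
by move=> ->.
Qed.

Let M0 w : M 0 w = 0%N.
Proof. by have /eqP := levy_start hM.1 w; rewrite pnatr_eq0 => /eqP. Qed.

Variable eta : R.
Hypothesis eta0 : 0 < eta.

Let F (s : R) := (\int[P]_w (expR (- (eta * (M s w)%:R)))%:E)%E.
Let p (s : R) (j : nat) : R := fine (P [set w | M s w = j]).

Let mF s : 0 <= s -> measurable_fun setT (fun w => expR (- (eta * (M s w)%:R))).
Proof.
move=> s0; apply: measurableT_comp; first exact: measurable_expR.
apply: measurableT_comp; first exact: oppr_measurable.
by apply: measurable_funM => //; exact: gcp_measurable.
Qed.

Let F01 (x : nat) : 0 <= expR (- (eta * x%:R)) <= 1.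
Proof.
by rewrite expR_ge0/= -expR0 ler_expR oppr_le0 mulr_ge0// ltW.
Qed.

Let Ffin s : 0 <= s -> F s = (fine (F s))%:E.
Proof.
move=> s0; rewrite fineK// ge0_fin_numE; last first.
  by apply: integral_ge0 => w _; rewrite lee_fin expR_ge0.
apply: (@le_lt_trans _ _ (\int[P]_w (cst 1%E w))%E); last first.
  by rewrite integral_cst1 ltry.
apply: ge0_le_integral => //.
- exact/measurable_EFinP/mF.
- by move=> w _; rewrite lee_fin; case/andP: (F01 (M s w)).
Qed.

Let incr_law s h (B : set R) : 0 <= s -> 0 <= h -> measurable B ->
  P [set w | B ((M (s + h) w)%:R - (M s w)%:R)] = P [set w | B (M h w)%:R].
Proof. by move=> s0 h0 mB; exact: (levy_stationary_increments hM.1 s0 h0 mB). Qed.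

Let incr_indep s h n (B : set R) : 0 <= s -> 0 <= h -> measurable B ->
  (P ([set w | M s w = n] `&`
      [set w | B ((M (s + h)%R w)%:R - (M s w)%:R)%R]) =
   P [set w | M s w = n] * P [set w | B ((M (s + h)%R w)%:R - (M s w)%:R)%R])%E.
Proof.
move=> s0 h0 mB.
(* Times [0], [s], [s + h], then constant. Since paths start at 0, the first increment is [M s]
   itself, and [C 0] selects its value [n]. *)
pose t i : R := if i is i'.+1 then (if i' is 0%N then s else s + h) else 0.
pose C i : set R := if i is 0%N then [set n%:R] else B.
have t_nd i : t i <= t i.+1 by case: i => [|[|i]]//=; rewrite lerDl.
have mC i : measurable (C i) by case: i => [|i] ; [exact: measurable_set1|exact: mB].
have := levy_indep_increments hM.1 2 (lexx _ : 0 <= t 0%N) t_nd mC.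
rewrite !big_ord_recl big_ord0 mule1/=.
have -> : [set w | (M s w)%:R - (M 0 w)%:R = n%:R :> R] = [set w | M s w = n].
  apply/seteqP; split => w /=; rewrite M0 subr0.
    by move=> /eqP; rewrite eqr_nat => /eqP.
  by move=> ->.
move=> <-; congr (P _); apply/seteqP; split => w /=.
  move=> [h1 h2] [|[|//]] _ //=.
  by rewrite M0 subr0 h1.
move=> H; split; last exact: (H 1%N).
by have /eqP := H 0%N isT; rewrite M0 subr0 eqr_nat => /eqP.
Qed.

(** [M (s + h)] is [M s] plus an increment that is independent of [M s] and has the law of [M h]. *)
Let FD s h : 0 <= s -> 0 <= h -> (F (s + h)%R = F s * F h)%E.
Proof.
move=> s0 h0; have sh0 : 0 <= s + h by rewrite addr_ge0.
pose D w : R := (M (s + h) w)%:R - (M s w)%:R.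
pose e (y : R) := (expR (- (eta * y)))%:E.
have me : measurable_fun setT e.
  apply/measurable_EFinP; apply: measurableT_comp; first exact: measurable_expR.
  apply: measurableT_comp; first exact: oppr_measurable.
  exact: measurable_funM.
have e0 y : (0 <= e y)%E by rewrite lee_fin expR_ge0.
have mD : measurable_fun setT D.
  by apply: measurable_funB; exact: gcp_measurable.
have lawD : (\int[P]_w e (D w) = F h)%E.
  rewrite -(@ge0_integral_pushforward _ _ _ _ R D mD P setT e)//.
  have mMh := gcp_measurable h0.
  rewrite /F -(@ge0_integral_pushforward _ _ _ _ R _ mMh P setT e)//.
  apply: eq_measure_integral => B mB _; exact: incr_law.
have Fe n : e n%:R = (expR (- (eta * n%:R)))%:E by [].
transitivity (\int[P]_w (e (M s w)%:R * e (D w)))%E.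
  apply: eq_integral => w _; rewrite -EFinM -expRD; congr (expR _)%:E.
  by rewrite /D; ring.
rewrite (@integral_indep_nat _ _ _ P (M s) _ (fun _ => D)
  (fun n y => e n%:R * e y)%E) //.
- transitivity (\int[P]_w (e (M s w)%:R * F h))%E.
    by apply: eq_integral => w _; rewrite ge0_integralZl// ?lawD//; exact: measurableT_comp.
  rewrite ge0_integralZr//.
  + exact/measurable_EFinP/mF.
  + exact: integral_ge0.
- by move=> n; exact: gcp_level_measurable.
- by move=> n; exact: measurable_funeM.
- by move=> n y; rewrite mule_ge0.
- by move=> n B mB; exact: incr_indep.
Qed.

Let p_ind h j : 0 <= h ->
  P.-integrable setT (fun w => ((M h w == j)%:R)%:E) /\
  (\int[P]_w ((M h w == j)%:R)%:E = (p h j)%:E)%E.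
Proof.
move=> h0; have mMj := gcp_level_measurable j h0.
have E w : (M h w == j)%:R = \1_[set w | M h w = j] w :> R.
  by rewrite indicE; congr (nat_of_bool _)%:R; apply/idP/idP; rewrite inE => /eqP.
split.
  apply: (le_integrable measurableT (g := EFin \o cst 1));
    last exact: finite_measure_integrable_cst.
    under eq_fun do rewrite E.
    by apply/measurable_EFinP; exact: measurable_indic.
  by move=> w _; rewrite /= lee_fin normr1 normr_nat lern1 leq_b1.
under eq_integral do rewrite E.
by rewrite integral_indic// setIT; exact: prob_fine.
Qed.

Let p_int h (c : nat -> R) : 0 <= h ->
  P.-integrable setT (fun w => (\sum_(1 <= j < k.+1) c j * (M h w == j)%:R)%:E) /\
  (\int[P]_w (\sum_(1 <= j < k.+1) c j * (M h w == j)%:R)%:E =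
   (\sum_(1 <= j < k.+1) c j * p h j)%:E)%E.
Proof.
move=> h0.
have E w : (\sum_(1 <= j < k.+1) c j * (M h w == j)%:R)%:E =
    (\sum_(1 <= j < k.+1) (c j)%:E * ((M h w == j)%:R)%:E)%E.
  by rewrite -sumEFin; apply: eq_bigr => j _; rewrite EFinM.
have icp j : P.-integrable setT (fun w => (c j)%:E * ((M h w == j)%:R)%:E)%E.
  by apply: integrableZl => //; exact: (p_ind j h0).1.
split.
  apply: (@eq_integrable _ _ _ P setT measurableT
    (fun w => \sum_(1 <= j < k.+1) (c j)%:E * ((M h w == j)%:R)%:E)%E).
    by move=> w _; rewrite E.
  by apply: integrable_sum.
under eq_integral do rewrite E.
rewrite integral_sum// -sumEFin; apply: eq_bigr => j _.
by rewrite integralZl ?(p_ind j h0).2//; exact: (p_ind j h0).1.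
Qed.

(** The transition condition at time 0 from state 0: that state has probability one, so the
    conditional probability is [Pr (M h = j)]. *)
Let trans_cvg j : (p h j - gcp_transition k lam j h) / h @[h --> 0^'+] --> (0 : R).
Proof.
have P0 : P [set w | M 0 w = 0%N] = 1%E.
  rewrite (_ : [set w | _] = setT); first exact: probability_setT.
  by apply/seteqP; split => w //= _; exact: M0.
have := hM.2 0 0%N j (lexx 0); rewrite P0 => /(_ lte01).
rewrite /small_o /cond_prob P0.
have SE h : [set w | M (0 + h) w = (0 + j)%N] `&` [set w | M 0 w = 0%N] =
    [set w | M h w = j].
  by rewrite add0r add0n; apply/seteqP; split => [w []|w]//=.
by under eq_fun do rewrite SE /= divr1.
Qed.

Let p_cvg j : (1 <= j <= k)%N -> p h j / h @[h --> 0^'+] --> lam j.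
Proof.
move=> /andP[j1 jk].
rewrite -[X in _ --> X]add0r.
apply: (@cvg_trans _ ((p h j - gcp_transition k lam j h) / h + lam j @[h --> 0^'+])).
  apply: near_eq_cvg; near=> h; have h0 : 0 < h by [].
  rewrite /gcp_transition gtn_eqF//= jk; field; rewrite gt_eqF//.
by apply: cvgD; [exact: trans_cvg|exact: cvg_cst].
Unshelve. all: by end_near. Qed.

Let p0_cvg : (p h 0 - 1) / h @[h --> 0^'+] --> - \sum_(1 <= j < k.+1) lam j.
Proof.
set L := \sum_(_ <= _ < _) _.
rewrite -[X in _ --> X]add0r.
apply: (@cvg_trans _ ((p h 0 - gcp_transition k lam 0 h) / h + - L @[h --> 0^'+])).
  apply: near_eq_cvg; near=> h; have h0 : 0 < h by [].
  by rewrite /gcp_transition/= -/L; field; rewrite gt_eqF.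
by apply: cvgD; [exact: trans_cvg|exact: cvg_cst].
Unshelve. all: by end_near. Qed.

Let iF s : 0 <= s -> P.-integrable setT (fun w => (expR (- (eta * (M s w)%:R)))%:E).
Proof.
move=> s0; apply: (le_integrable measurableT (g := EFin \o cst 1));
  last exact: finite_measure_integrable_cst.
  exact/measurable_EFinP/mF.
move=> w _; have /andP[? ?] := F01 (M s w).
by rewrite /= lee_fin normr1 ger0_norm.
Qed.

(** Values of [M h] above [k] are counted as 1 here and as 0 in [F_ge]. Neither bound mentions their
    probability, yet the two have the same slope at [h = 0], because the slope of [p h 0] is minus
    the sum of the rates. *)
Let F_le h : 0 <= h ->
  fine (F h) <= 1 - \sum_(1 <= j < k.+1) (1 - expR (- (eta * j%:R))) * p h j.
Proof.
move=> h0; have [i1 E1] := p_int (fun j => 1 - expR (- (eta * j%:R))) h0.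
rewrite lerBrDr -lee_fin EFinD -Ffin// -E1 /F -integralD//; last exact: iF.
rewrite -(integral_cst1 P).
apply: ge0_le_integral => //.
- move=> w _; rewrite -EFinD lee_fin addr_ge0 ?expR_ge0//.
  by apply: sumr_ge0 => j _; rewrite mulr_ge0// subr_ge0; case/andP : (F01 j).
- by apply: emeasurable_funD; [exact/measurable_EFinP/mF|exact: measurable_int i1].
- move=> w _; rewrite sum_pred1 -EFinD lee_fin.
  have /andP[? ?] := F01 (M h w); case: ifP => _; lra.
Qed.

Let F_ge h : 0 <= h ->
  p h 0 + \sum_(1 <= j < k.+1) expR (- (eta * j%:R)) * p h j <= fine (F h).
Proof.
move=> h0; have [i1 E1] := p_int (fun j => expR (- (eta * j%:R))) h0.
have [i2 E2] := p_ind 0 h0.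
rewrite -lee_fin EFinD -Ffin// -E1 -E2 -integralD//.
apply: le_integral => //; [exact: integrableD|exact: iF|].
move=> w _; rewrite sum_pred1 -EFinD lee_fin.
have /andP[? ?] := F01 (M h w).
case: (M h w) => [|m]/=; first by rewrite mulr0 oppr0 expR0 addr0.
by rewrite add0r; case: ifP => // _; rewrite expR_ge0.
Qed.

Lemma gcp_laplace s : 0 <= s ->
  (\int[P]_w (expR (- (eta * (M s w)%:R)))%:E =
   (expR (- (s * gcp_exponent k lam eta)))%:E)%E.
Proof.
move=> s0; rewrite -/(F s) Ffin//; congr EFin.
apply: (@semigroup_exp R (fun s => fine (F s))) => //.
- rewrite (_ : F 0 = 1%E)// -(integral_cst1 P); apply: eq_integral => w _.
  by rewrite M0 mulr0 oppr0 expR0.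
- by move=> u v u0 v0; rewrite FD// Ffin// (Ffin v0) -EFinM.
rewrite /gcp_exponent.
have sumE (h : R) (c : nat -> R) : (\sum_(1 <= j < k.+1) c j * p h j) / h =
    \sum_(1 <= j < k.+1) c j * (p h j / h).
  by rewrite mulr_suml; apply: eq_bigr => j _; rewrite mulrA.
have sum_cvg (c : nat -> R) :
    (\sum_(1 <= j < k.+1) c j * p h j) / h @[h --> 0^'+] -->
    \sum_(1 <= j < k.+1) c j * lam j.
  under eq_fun do rewrite sumE big_nat.
  rewrite big_nat; apply: cvg_big => [|j jk].
    exact: add_continuous.
  by apply: cvgM; [exact: cvg_cst|exact: p_cvg].
apply: (@squeeze_cvgr _ _ _ _
  (fun h => (p h 0 - 1) / h + (\sum_(1 <= j < k.+1) expR (- (eta * j%:R)) * p h j) / h)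
  (fun h => - ((\sum_(1 <= j < k.+1) (1 - expR (- (eta * j%:R))) * p h j) / h))).
- near=> h; have h0 : 0 < h by [].
  rewrite -mulrDl -mulNr !ler_pM2r ?invr_gt0//.
  have := F_le (ltW h0); have := F_ge (ltW h0); lra.
- rewrite [X in _ --> X](_ : _ = - (\sum_(1 <= j < k.+1) lam j) +
    \sum_(1 <= j < k.+1) expR (- (eta * j%:R)) * lam j).
    by apply: cvgD; [exact: p0_cvg|exact: sum_cvg].
  rewrite -!sumrN -big_split/=; apply: eq_bigr => j _; ring.
- apply: cvgN; under [X in _ --> X]eq_bigr do rewrite mulrC.
  exact: sum_cvg.
Unshelve. all: by end_near. Qed.

End gcp.

(** * Subordination *)

Lemma laplace_cvg (R : realType) d (T : measurableType d) (P : probability T R)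
    (Y_ : nat -> T -> R) (Y : T -> R) (c : R) :
  0 <= c -> (forall n, measurable_fun setT (Y_ n)) -> measurable_fun setT Y ->
  (forall n w, 0 <= Y_ n w) -> (forall w, Y_ n w @[n --> \oo] --> Y w) ->
  (\int[P]_w (expR (- (c * Y_ n w)))%:E @[n --> \oo] -->
   \int[P]_w (expR (- (c * Y w)))%:E)%E.
Proof.
move=> c0 mY_ mY Y0 YY.
have me (f : T -> R) : measurable_fun setT f ->
    measurable_fun setT (fun w => (expR (- (c * f w)))%:E).
  move=> mf; apply/measurable_EFinP; apply: measurableT_comp; first exact: measurable_expR.
  by apply: measurableT_comp; [exact: oppr_measurable|exact: measurable_funM].
have [] := @dominated_convergence _ T R P setT measurableT
  (fun n w => (expR (- (c * Y_ n w)))%:E) (fun w => (expR (- (c * Y w)))%:E)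
  (EFin \o cst 1) => //.
- by move=> n; exact: me.
- exact: me.
- apply: aeW => w _; apply: cvg_EFin; first exact: nearW.
  apply: continuous_cvg; first exact: continuous_expR.
  by apply: cvgN; apply: cvgM => //; exact: cvg_cst.
- exact: finite_measure_integrable_cst.
- apply: aeW => w n _; rewrite /= lee_fin ger0_norm ?expR_ge0//.
  by rewrite -expR0 ler_expR oppr_le0 mulr_ge0.
Qed.

Section subordination.
Variables (R : realType) (d : measure_display) (T : measurableType d).
Variables (P : probability T R) (k : nat) (lam : nat -> R).
Variables (M : R -> T -> nat) (G : R -> T -> R) (phi : R -> R).
Hypotheses (hM : is_gcp P k lam M) (hG : is_subordinator P phi G).
Hypothesis hMG : indep_processes P (fun t w => (M t w)%:R) G.
Variable t : R.
Hypothesis t0 : 0 <= t.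

Let G0 w : 0 <= G t w.
Proof.
by case: hG => levG monG _; rewrite -(levy_start levG w); exact: monG.
Qed.

Let mG : measurable_fun setT (G t).
Proof. by case: hG => levG _ _; exact: (levy_measurable levG t0). Qed.

(* [G t] is approximated from strictly above on a grid of mesh [1 / n.+1], so
   that the right-continuity of [M] applies. *)
Let N n w := Num.truncn (n.+1%:R * G t w).
Let r (n m : nat) : R := m.+1%:R / n.+1%:R.

Let r0 n m : 0 <= r n m. Proof. by rewrite divr_ge0. Qed.

Let N_itv n w : (N n w)%:R / n.+1%:R <= G t w < r n (N n w).
Proof.
have /andP[h1 h2] := truncn_itv (mulr_ge0 (ler0n R n.+1) (G0 w)).
by rewrite ler_pdivrMr// ltr_pdivlMr// mulrC h1.
Qed.

Let N_level n m :
  [set w | N n w = m] = G t @^-1` `[m%:R / n.+1%:R, r n m[%classic.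
Proof.
apply/seteqP; split => w /=; rewrite in_itv/=; first by move=> <-; exact: N_itv.
rewrite ler_pdivrMr// ltr_pdivlMr// mulrC => h.
by apply/truncn_def.
Qed.

Let mN n m : measurable [set w | N n w = m].
Proof. by rewrite N_level -[X in measurable X]setTI; apply: mG. Qed.

Let r_cvg w : r n (N n w) @[n --> \oo] --> G t w.
Proof.
apply: (@squeeze_cvgr _ _ _ _ (fun=> G t w) (fun n => G t w + n.+1%:R^-1)).
- apply: nearW => n; have /andP[h1 h2] := N_itv n w.
  by rewrite ltW//= /r -natr1 mulrDl mul1r lerD2r.
- exact: cvg_cst.
- by rewrite -[X in _ --> X]addr0; apply: cvgD; [exact: cvg_cst|exact: cvg_harmonic].
Qed.

Let MN_measurable n : measurable_fun setT (fun w => (M (r n (N n w)) w)%:R : R).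
Proof.
apply: (measurable_fun_levels (mN n)) => m.
apply: (eq_measurable_fun (fun w => (M (r n m) w)%:R : R)).
  by move=> w; rewrite inE/= => ->.
by apply: measurable_funTS; exact: (gcp_measurable hM).
Qed.

Let MN_cvg w : (M (r n (N n w)) w)%:R @[n --> \oo] --> ((M (G t w) w)%:R : R).
Proof.
have /cvg_at_rightP := @levy_right_continuous _ _ _ _ _ hM.1 w _ (G0 w).
apply; split => [n|]; last exact: r_cvg.
by have /andP[] := N_itv n w.
Qed.

(** A pointwise limit of the grid versions, each of which coincides with a single [M (r n m)] on the
    level [N n = m]. *)
Lemma subordinated_measurable : measurable_fun setT (fun w => (M (G t w) w)%:R : R).
Proof. by apply: measurable_fun_cvg MN_measurable _ => w _; exact: MN_cvg. Qed.

Let indepN n m (B : set R) : measurable B ->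
  (P ([set w | N n w = m] `&` (fun w => (M (r n m) w)%:R : R) @^-1` B) =
   P [set w | N n w = m] * P ((fun w => (M (r n m) w)%:R : R) @^-1` B))%E.
Proof.
move=> mB; rewrite setIC muleC; apply: hMG.
  apply: sub_sigma_algebra; exists (r n m); first exact: r0.
  by exists B => //; rewrite setTI.
apply: sub_sigma_algebra; exists t => //.
exists `[m%:R / n.+1%:R, r n m[%classic; first exact: measurable_itv.
by rewrite setTI N_level.
Qed.

(** On the grid, conditioning on [N n] replaces [exp (- eta M)] at the random time by
    [exp (- psi r)]. Dominated convergence on both sides then identifies the transform of [M (G t)]
    at [eta] with that of [G t] at [psi]. *)
Lemma subordinated_laplace (eta : R) : 0 < eta -> 0 < gcp_exponent k lam eta ->
  (\int[P]_w (expR (- (eta * (M (G t w) w)%:R)))%:E =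
   (expR (- (t * phi (gcp_exponent k lam eta))))%:E)%E.
Proof.
move=> eta0; set psi := gcp_exponent k lam eta => psi0.
have cvg1 := @laplace_cvg _ _ _ P _ _ _ (ltW eta0) MN_measurable subordinated_measurable
  (fun n w => ler0n R _) MN_cvg.
have mr n : measurable_fun setT (fun w => r n (N n w)).
  apply: (measurable_fun_levels (mN n)) => m.
  apply: (eq_measurable_fun (cst (r n m))) => [w|]; last exact: measurable_cst.
  by rewrite inE/= => ->.
have cvg2 := @laplace_cvg _ _ _ P _ _ _ (ltW psi0) mr mG (fun n w => r0 n (N n w)) r_cvg.
have E n : (\int[P]_w (expR (- (eta * (M (r n (N n w)) w)%:R)))%:E =
    \int[P]_w (expR (- (psi * r n (N n w))))%:E)%E.
  rewrite (@integral_indep_nat _ _ _ P (N n) (mN n) (fun m w => (M (r n m) w)%:R : R)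
    (fun _ y => (expR (- (eta * y)))%:E)).
  - apply: eq_integral => w _; rewrite (gcp_laplace hM eta0)//.
    by rewrite mulrC.
  - by move=> m; exact: (gcp_measurable hM).
  - move=> m; apply/measurable_EFinP; apply: measurableT_comp; first exact: measurable_expR.
    by apply: measurableT_comp; [exact: oppr_measurable|exact: measurable_funM].
  - by move=> m y; rewrite lee_fin expR_ge0.
  - by move=> m B mB; exact: indepN.
have -> : (\int[P]_w (expR (- (eta * (M (G t w) w)%:R)))%:E =
    \int[P]_w (expR (- (psi * G t w)))%:E)%E.
  have EE : (fun n => \int[P]_w (expR (- (eta * (M (r n (N n w)) w)%:R)))%:E)%E =
      (fun n => \int[P]_w (expR (- (psi * r n (N n w))))%:E)%E by exact/funext.
  by move: cvg1; rewrite EE => cvg1; exact: (cvg_unique _ cvg1 cvg2).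
case: hG => _ _ /(_ t psi t0 psi0); rewrite unlock.
rewrite -mulNr => <-; apply: eq_integral => w _.
by rewrite mulNr.
Qed.

End subordination.

(** * Behaviour of the exponents at 0 *)

Lemma gcp_exponent_gt0 (R : realType) (k : nat) (lam : nat -> R) (eta : R) :
  (1 <= k)%N -> (forall j, (1 <= j <= k)%N -> 0 < lam j) -> 0 < eta ->
  0 < gcp_exponent k lam eta.
Proof.
move=> k1 lam0 eta0; rewrite /gcp_exponent big_ltn ?ltnS//.
apply: ltr_wpDr; last first.
  rewrite mulr_gt0 ?lam0// ?k1// subr_gt0 -[ltRHS]expR0 ltr_expR oppr_lt0.
  by rewrite mulr1.
rewrite big_nat; apply: sumr_ge0 => j /andP[j1 jk].
rewrite mulr_ge0//; first by rewrite ltW// lam0// (ltnW j1).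
by rewrite subr_ge0 -[leRHS]expR0 ler_expR oppr_le0 mulr_ge0// ltW.
Qed.

(** Squeezed between [c exp (- s c)] and [c], by [1 + x <= exp x] at [x = s c] and at
    [x = - s c]. *)
Lemma expRN_slope (R : realType) (c : R) : 0 <= c ->
  (1 - expR (- (s * c))) / s @[s --> 0^'+] --> c.
Proof.
move=> c0.
have lo : c * expR (- (s * c)) @[s --> 0^'+] --> c.
  apply: cvg_at_right_filter.
  rewrite [X in _ --> X](_ : _ = c * expR (- (0 * c))); last first.
    by rewrite mul0r oppr0 expR0 mulr1.
  apply: cvgM; first exact: cvg_cst.
  apply: continuous_cvg; first exact: continuous_expR.
  by apply: cvgN; apply: cvgM; [exact: cvg_id|exact: cvg_cst].
apply: (squeeze_cvgr _ lo (cvg_cst c)); near=> s.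
have s0 : 0 < s by [].
rewrite ler_pdivlMr// ler_pdivrMr//; apply/andP; split.
  have := expR_ge1Dx (s * c); rewrite expRN => h.
  rewrite mulrAC -(ler_pM2r (expR_gt0 (s * c))) mulrBl mul1r mulfVK ?gt_eqF ?expR_gt0//.
  by rewrite mulVf ?gt_eqF ?expR_gt0//; lra.
by have := expR_ge1Dx (- (s * c)); lra.
Unshelve. all: by end_near. Qed.

Lemma gcp_exponent_slope (R : realType) (k : nat) (lam : nat -> R) :
  gcp_exponent k lam s / s @[s --> 0^'+] --> \sum_(1 <= j < k.+1) j%:R * lam j.
Proof.
have E (s : R) : gcp_exponent k lam s / s =
    \sum_(1 <= j < k.+1) (1 - expR (- (s * j%:R))) / s * lam j.
  by rewrite /gcp_exponent mulr_suml; apply: eq_bigr => j _; rewrite -mulrA mulrC.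
under eq_fun do rewrite E.
apply: cvg_big => [|j _]; first exact: add_continuous.
by apply: cvgM; [exact: expRN_slope|exact: cvg_cst].
Qed.

Lemma gcp_exponent_cvg0 (R : realType) (k : nat) (lam : nat -> R) :
  gcp_exponent k lam s @[s --> 0^'+] --> (0 : R).
Proof.
rewrite -[X in _ --> X](mul0r (\sum_(1 <= j < k.+1) j%:R * lam j)).
apply: (@cvg_trans _ (s * (gcp_exponent k lam s / s) @[s --> 0^'+])).
  apply: near_eq_cvg; near=> s; have s0 : 0 < s by [].
  by rewrite mulrC divfK// gt_eqF.
by apply: cvgM; [exact: cvg_within|exact: gcp_exponent_slope].
Unshelve. all: by end_near. Qed.

(* [x exp (- x) <= 1 - exp (- x) <= x] with [x = t phi(psi s)], where the
   incomplete gamma bounds place [phi(psi s)] between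
   [exp (- eps psi s) (psi s)^alpha] and [(psi s)^alpha]. *)
Lemma subordinated_laplace_asymp (R : realType) (psi : R -> R) (alpha eps t c : R) :
  0 < alpha -> 0 < eps -> 0 <= t -> 0 < c ->
  (forall s, 0 < s -> 0 < psi s) -> psi s / s @[s --> 0^'+] --> c ->
  psi s @[s --> 0^'+] --> (0 : R) ->
  s `^ (- alpha) * (1 - expR (- (t * (alpha * eps `^ (- alpha) *
     lower_gamma alpha (psi s * eps))))) @[s --> 0^'+] --> t * c `^ alpha.
Proof.
move=> a0 eps0 t0 c0 psi0 psic psi_0.
have qc : (psi s / s) `^ alpha @[s --> 0^'+] --> c `^ alpha.
  apply: (@cvg_comp _ _ _ (fun s => psi s / s) (fun x : R => x `^ alpha) _ (nbhs c)) => //.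
  exact: powR_continuous.
have hi : t * (psi s / s) `^ alpha @[s --> 0^'+] --> t * c `^ alpha.
  by apply: cvgM => //; exact: cvg_cst.
have expR_to1 (h : R -> R) : h s @[s --> 0^'+] --> (0 : R) ->
    expR (- h s) @[s --> 0^'+] --> (1 : R).
  move=> h0; rewrite -[X in _ --> X]expR0 -[X in _ --> expR X]oppr0.
  by apply: continuous_cvg; [exact: continuous_expR|exact: cvgN].
have psia : psi s `^ alpha @[s --> 0^'+] --> (0 : R).
  apply: cvg_trans (powR_cvg0 a0).
  apply: (@cvg_comp _ _ _ psi (fun x : R => x `^ alpha)); last exact: cvg_id.
  by apply: cvg_at_right0 => //; near=> s; exact: psi0.
have lo : t * (psi s / s) `^ alpha * expR (- (psi s * eps)) *
    expR (- (t * psi s `^ alpha)) @[s --> 0^'+] --> t * c `^ alpha.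
  rewrite [X in _ --> X](_ : _ = t * c `^ alpha * 1 * 1); last by rewrite !mulr1.
  apply: cvgM.
    apply: cvgM => //; apply: expR_to1.
    by rewrite -[X in _ --> X](mul0r eps); apply: cvgM => //; exact: cvg_cst.
  apply: expR_to1; rewrite -[X in _ --> X](mulr0 t).
  by apply: cvgM => //; exact: cvg_cst.
apply: (squeeze_cvgr _ lo hi); near=> s.
have s0 : 0 < s by [].
have ps0 := psi0 s s0.
have pse : 0 < psi s * eps by rewrite mulr_gt0.
set phi := alpha * _ * _.
have [phi_lo phi_hi] : psi s `^ alpha * expR (- (psi s * eps)) <= phi /\
    phi <= psi s `^ alpha.
  have /andP[] := lower_gamma_bounds a0 pse; rewrite /phi.
  rewrite powRM ?(ltW ps0) ?(ltW eps0)// powRN => h1 h2.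
  have e0 : 0 < eps `^ alpha by exact: powR_gt0.
  have k0 : 0 < alpha * (eps `^ alpha)^-1 by rewrite mulr_gt0 ?invr_gt0.
  split.
    rewrite [leLHS](_ : _ = alpha * (eps `^ alpha)^-1 * (expR (- (psi s * eps)) *
        (psi s `^ alpha * eps `^ alpha / alpha))); first by rewrite ler_pM2l.
    by field; rewrite !gt_eqF.
  rewrite [leRHS](_ : _ = alpha * (eps `^ alpha)^-1 *
      (psi s `^ alpha * eps `^ alpha / alpha)); first by rewrite ler_pM2l.
  by field; rewrite !gt_eqF.
have phi0 : 0 <= phi.
  by apply: le_trans phi_lo; rewrite mulr_ge0 ?powR_ge0 ?expR_ge0.
have sa : 0 <= s `^ (- alpha) by exact: powR_ge0.
have -> : (psi s / s) `^ alpha = s `^ (- alpha) * psi s `^ alpha.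
  by rewrite powRM ?invr_ge0 ?(ltW ps0) ?(ltW s0)// -powR_inv1 ?(ltW s0)// -powRrM mulN1r mulrC.
apply/andP; split; last first.
  rewrite [leRHS]mulrCA ler_wpM2l//; have := expR_ge1Dx (- (t * phi)).
  have : t * phi <= t * psi s `^ alpha by rewrite ler_wpM2l.
  by lra.
rewrite [leLHS](_ : _ = s `^ (- alpha) * (t * (psi s `^ alpha * expR (- (psi s * eps))) *
  expR (- (t * psi s `^ alpha)))); last by ring.
rewrite ler_wpM2l//.
(* The lower bound on [phi] enters through the factor, the upper bound through the exponential. *)
apply: (@le_trans _ _ (t * phi * expR (- (t * phi)))).
  apply: ler_pM => //.
  - by rewrite !mulr_ge0 ?powR_ge0 ?expR_ge0.
  - by rewrite ler_wpM2l.
  - by rewrite ler_expR lerN2 ler_wpM2l.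
have := expR_ge1Dx (t * phi); rewrite -(ler_pM2r (expR_gt0 (- (t * phi)))).
by rewrite mulrDl mul1r -expRD subrr expR0; lra.
Unshelve. all: by end_near. Qed.

(* For [alpha = 1] or [t = 0] the right-hand side of the equivalence is the zero
   function (1/Gamma(0) = 0) and a quotient by it is meaningless.  The second
   conjunct is the equivalence after multiplication by y^alpha, which keeps its
   meaning there. *)
Theorem proposition5p1 (R : realType) (d : measure_display)
    (T : measurableType d) (P : probability T R)
    (k : nat) (lam : nat -> R) (alpha eps : R)
    (M : R -> T -> nat) (G : R -> T -> R)
    (hk : (1 <= k)%N)
    (hlam : forall j : nat, (1 <= j <= k)%N -> 0 < lam j)
    (halpha : 0 < alpha <= 1) (heps : 0 < eps)
    (hM : is_gcp P k lam M)
    (hG : is_subordinator P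
            (fun eta => alpha * eps `^ (- alpha) * lower_gamma alpha (eta * eps))
            G)
    (hMG : indep_processes P (fun t w => (M t w)%:R) G) :
  let tail (t y : R) : R := fine (P [set w | y < (M (G t w) w)%:R]) in
  let c1 : R := \sum_(1 <= j < k.+1) j%:R * lam j in
  (forall t : R, 0 < t -> alpha < 1 ->
     asymp_equiv (tail t)
       (fun y => t * c1 `^ alpha * y `^ (- alpha) / fine (Gamma (1 - alpha)))) /\
  (forall t : R, 0 <= t ->
     y `^ alpha * tail t y @[y --> +oo] -->
       t * c1 `^ alpha * fine ((Gamma (1 - alpha))^-1)%E).
Proof.
move=> tail c1; have /andP[a0 a1] := halpha.
have c1_gt0 : 0 < c1.
  rewrite /c1 big_ltn ?ltnS//; apply: ltr_wpDr.
    rewrite big_nat; apply: sumr_ge0 => j /andP[j1 jk].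
    by rewrite mulr_ge0// ltW// hlam// (ltnW j1).
  by rewrite mul1r hlam// hk.
pose Gi := fine ((Gamma (1 - alpha))^-1)%E.
have GiE : alpha < 1 -> Gi = (fine (Gamma (1 - alpha)))^-1.
  move=> a1'; have a01 : 0 < alpha < 1 by rewrite a0.
  have g0 := fine_Gamma_gt0 a01.
  by rewrite /Gi -[in LHS](fineK (Gamma_fin a01)) inver gt_eqF.
have key t : 0 <= t ->
    s `^ (- alpha) * tail t s^-1 @[s --> 0^'+] --> t * c1 `^ alpha * Gi.
  move=> t0.
  have lap : s `^ (- alpha) * (1 - fine (\int[P]_w
      (expR (- (s * (M (G t w) w)%:R)))%:E)%E) @[s --> 0^'+] --> t * c1 `^ alpha.
    have := subordinated_laplace_asymp a0 heps t0 c1_gt0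
      (fun s => gcp_exponent_gt0 hk hlam) (@gcp_exponent_slope _ k lam)
      (@gcp_exponent_cvg0 _ k lam).
    apply: cvg_trans.
    apply: near_eq_cvg; near=> s; have s0 : 0 < s by [].
    by rewrite (subordinated_laplace hM hG hMG t0 s0 (gcp_exponent_gt0 hk hlam s0)).
  have mX := subordinated_measurable hM hG t0.
  have X0 w : 0 <= (M (G t w) w)%:R :> R by [].
  have [a1'|] := ltP alpha 1.
    by rewrite GiE//; exact: (tail_asymptotics_lt1 mX X0 a0 lap).
  move=> a1'; have aE : alpha = 1 by apply/le_anti; rewrite a1.
  (* The inverse is taken in the extended reals before [fine], so [Gamma 0 = +oo] gives the limit
     0. *)
  rewrite /Gi aE subrr Gamma0 invey mulr0 -aE.
  exact: (tail_asymptotics1 mX X0 a0 lap).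
have lim t : 0 <= t -> y `^ alpha * tail t y @[y --> +oo] --> t * c1 `^ alpha * Gi.
  (* The substitution [s = 1 / y] moves the limit from the right of 0 to infinity. *)
  move=> t0; have := cvg_comp _ _ (@cvgVy_at_right R) (key t t0); apply: cvg_trans.
  apply: near_eq_cvg; near=> y; have y0 : 0 < y by near: y; exact: nbhs_pinfty_gt.
  by rewrite /= invrK -powR_inv1 ?ltW// -powRrM mulN1r opprK.
split; last exact: lim.
move=> t t0 a1'; rewrite /asymp_equiv -GiE//.
have a01 : 0 < alpha < 1 by rewrite a0.
have Gi0 : 0 < Gi by rewrite GiE// invr_gt0 fine_Gamma_gt0.
pose K := t * c1 `^ alpha * Gi.
have K0 : 0 < K by rewrite !mulr_gt0// powR_gt0.
rewrite -[X in _ --> X](divff (lt0r_neq0 K0)).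
apply: (@cvg_trans _ (y `^ alpha * tail t y / K @[y --> +oo])).
  apply: near_eq_cvg; near=> y; have y0 : 0 < y by near: y; exact: nbhs_pinfty_gt.
  have ya0 : 0 < y `^ alpha by rewrite powR_gt0.
  rewrite powRN /K; field.
  by rewrite !gt_eqF// powR_gt0.
by apply: cvgM; [exact: lim (ltW t0)|exact: cvg_cst].
Unshelve. all: by end_near. Qed.
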